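(* There is an algorithm which, given any instance of $n$ jobs as described in the context (common integer length $p\ge 1$, and for each job $j$ integers $r_j$, $d_j$, $w_j\ge 0$), computes a maximum-weight feasible set of jobs (equivalently, together with an earliest-deadline schedule of that set, a preemptive schedule of maximum weighted throughput), and runs in time $O(n^4)$.
   Context: Scheduling problem $1|r_j;\,p_j=p;\,\text{pmtn}|\sum w_jU_j$. We are given $n$ jobs $1,\dots,n$, all of the same integer processing length $p\ge 1$; each job $j$ has an integer release time $r_j$, integer deadline $d_j$ and integer weight $w_j\ge 0$. A time unit $t$ (an integer) denotes the interval $[t,t+1)$. A preemptive schedule $S$ assigns to each job $j$ a set $S(j)$ of time units such that $S(j)\subseteq[r_j,d_j)$ for every $j$ and $S(i)\cap S(j)=\emptyset$ for $i\neq j$ (single machine; the time units assigned to a job need not be consecutive). The schedule completes job $j$ if $|S(j)|=p$. The weighted throughput of $S$ is $\sum_{j:\,|S(j)|=p} w_j$, and the goal is to maximize it. A set $\mathcal{J}$ of jobs is feasible if some schedule completes every job in $\mathcal{J}$; its weight is $w(\mathcal{J})=\sum_{j\in\mathcal{J}}w_j$. A maximum-weight feasible set is a feasible set of largest weight; its weight equals the maximum weighted throughput over all schedules. Running time is measured with unit-cost arithmetic and comparisons on the input integers. *)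

(* Defs.v *)
From mathcomp Require Import all_boot all_order all_algebra.
From mathcomp Require Import finmap.

Set Implicit Arguments.
Unset Strict Implicit.
Unset Printing Implicit Defensive.

Import Order.TTheory GRing.Theory Num.Theory.

Local Open Scope ring_scope.

Record instance (n : nat) := Instance {
  plen : nat;
  plen_gt0 : (0 < plen)%N;
  release : 'I_n -> int;
  deadline : 'I_n -> int;
  weight : 'I_n -> nat }.

(* The integer t stands for the time unit [t, t + 1). *)
Definition assignment (n : nat) := 'I_n -> {fset int}.

Definition is_schedule n (I : instance n) (S : assignment n) : Prop :=
  (forall j t, t \in S j -> release I j <= t < deadline I j) /\
  (forall i j, i != j -> [disjoint S i & S j]%fset).

Definition completes n (I : instance n) (S : assignment n) (j : 'I_n) : bool :=
  #|` S j| == plen I.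

Definition throughput n (I : instance n) (S : assignment n) : nat :=
  (\sum_(j < n | completes I S j) weight I j)%N.

Definition max_throughput n (I : instance n) (S : assignment n) : Prop :=
  is_schedule I S /\
  forall S', is_schedule I S' -> (throughput I S' <= throughput I S)%N.

Definition feasible n (I : instance n) (J : {set 'I_n}) : Prop :=
  exists S, is_schedule I S /\ forall j, j \in J -> completes I S j.

Definition set_weight n (I : instance n) (J : {set 'I_n}) : nat :=
  (\sum_(j in J) weight I j)%N.

Definition max_weight_feasible n (I : instance n) (J : {set 'I_n}) : Prop :=
  feasible I J /\
  forall J', feasible I J' -> (set_weight I J' <= set_weight I J)%N.

Definition pending n (I : instance n) (S : assignment n) (t : int) (j : 'I_n)
    : bool :=
  (release I j <= t) && (#|` [fset u in S j | (u < t)%R]%fset| < plen I)%N.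

(* Whenever some job of J is pending, a job of J runs, and no pending job of J
   has a smaller deadline than the one that runs; ties are broken freely. *)
Definition earliest_deadline_schedule n (I : instance n) (J : {set 'I_n})
    (S : assignment n) : Prop :=
  [/\ is_schedule I S,
      forall j, j \in J -> completes I S j,
      forall j, j \notin J -> S j = fset0 &
      forall t i, i \in J -> pending I S t i ->
        exists j, [/\ j \in J, t \in S j & deadline I j <= deadline I i]].

(* The model of computation is a random access machine over the integers,
   programmed by structured commands over finitely many (those named in the
   program) integer variables and integer-indexed integer arrays.  Each node of
   an evaluated expression (constant, variable or array access, arithmetic
   operation, comparison) and each executed assignment or test costs one unit.

   Unit-cost multiplication and division would be unreasonably powerful on
   integers of unbounded size, so an execution is relative to a bound B on the
   absolute values of all the results of operations: an execution that exceeds B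
   is stuck. *)

Inductive binop := OpAdd | OpSub | OpMul | OpDiv | OpEq | OpLe | OpLt.

(* %/ is Euclidean division, that is, the floor for a positive divisor; the
   quotient by 0 is 0. *)
Definition eval_op (o : binop) (x y : int) : int :=
  match o with
  | OpAdd => x + y
  | OpSub => x - y
  | OpMul => x * y
  | OpDiv => (x %/ y)%Z
  | OpEq => (x == y)%R%:Z
  | OpLe => (x <= y)%R%:Z
  | OpLt => (x < y)%R%:Z
  end.

Inductive expr :=
  | Const (z : int)
  | Var (x : nat)
  | Read (a : nat) (e : expr)
  | Op (o : binop) (e1 e2 : expr).

Inductive cmd :=
  | Skip
  | Assign (x : nat) (e : expr)
  | Write (a : nat) (e1 e2 : expr)
  | Seq (c1 c2 : cmd)
  | If (e : expr) (c1 c2 : cmd)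
  | While (e : expr) (c : cmd).

Record state := State {
  vars : nat -> int;
  arrs : nat -> int -> int }.

Definition set_var (s : state) (x : nat) (v : int) : state :=
  State (fun y => if y == x then v else vars s y) (arrs s).

Definition set_arr (s : state) (a : nat) (i v : int) : state :=
  State (vars s)
    (fun b j => if (b == a) && (j == i) then v else arrs s b j).

Fixpoint eval (s : state) (e : expr) : int :=
  match e with
  | Const z => z
  | Var x => vars s x
  | Read a e => arrs s a (eval s e)
  | Op o e1 e2 => eval_op o (eval s e1) (eval s e2)
  end.

Fixpoint within (B : nat) (s : state) (e : expr) : bool :=
  match e with
  | Const _ | Var _ => true
  | Read _ e => within B s e
  | Op o e1 e2 => [&& within B s e1, within B s e2 & (`|eval s e|%N <= B)%N]
  end.

Fixpoint cost (e : expr) : nat :=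
  match e with
  | Const _ | Var _ => 1
  | Read _ e => (cost e).+1
  | Op _ e1 e2 => (cost e1 + cost e2).+1
  end.

(* exec B c s t s': from state s, command c halts in state s' after t units of
   time.  A test succeeds when its value is nonzero. *)
Inductive exec (B : nat) : cmd -> state -> nat -> state -> Prop :=
  | ExecSkip s :
      exec B Skip s 1 s
  | ExecAssign s x e :
      within B s e ->
      exec B (Assign x e) s (cost e).+1 (set_var s x (eval s e))
  | ExecWrite s a e1 e2 :
      within B s e1 -> within B s e2 ->
      exec B (Write a e1 e2) s (cost e1 + cost e2).+1
        (set_arr s a (eval s e1) (eval s e2))
  | ExecSeq s1 s2 s3 c1 c2 t1 t2 :
      exec B c1 s1 t1 s2 -> exec B c2 s2 t2 s3 ->
      exec B (Seq c1 c2) s1 (t1 + t2)%N s3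
  | ExecIfTrue s s' e c1 c2 t :
      within B s e -> eval s e != 0 -> exec B c1 s t s' ->
      exec B (If e c1 c2) s (cost e + t).+1 s'
  | ExecIfFalse s s' e c1 c2 t :
      within B s e -> eval s e = 0 -> exec B c2 s t s' ->
      exec B (If e c1 c2) s (cost e + t).+1 s'
  | ExecWhileTrue s1 s2 s3 e c t1 t2 :
      within B s1 e -> eval s1 e != 0 ->
      exec B c s1 t1 s2 -> exec B (While e c) s2 t2 s3 ->
      exec B (While e c) s1 (cost e + t1 + t2).+1 s3
  | ExecWhileFalse s e c :
      within B s e -> eval s e = 0 ->
      exec B (While e c) s (cost e).+1 s.

Definition array_of n (f : 'I_n -> int) (i : int) : int :=
  match i with
  | Posz m => oapp f 0 (insub m)
  | Negz _ => 0
  end.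

(* Variables 0 and 1 hold n and p; arrays 0, 1 and 2 hold the release times,
   deadlines and weights at indices 0, ..., n - 1; everything else is 0. *)
Definition input_state n (I : instance n) : state :=
  State
    (fun x => match x with 0%N => n%:Z | 1%N => (plen I)%:Z | _ => 0 end)
    (fun a => match a with
              | 0%N => array_of (release I)
              | 1%N => array_of (deadline I)
              | 2%N => array_of (fun j => (weight I j)%:Z)
              | _ => fun=> 0
              end).

(* Array 3 holds the output, as the indicator of a set of jobs. *)
Definition output_set n (s : state) : {set 'I_n} :=
  [set j : 'I_n | arrs s 3 j%:Z != 0].

Definition magnitude n (I : instance n) : nat :=
  (n + plen I + \max_(j < n)
     maxn `|release I j| (maxn `|deadline I j| (weight I j)))%N.

(* Polynomial in n and the largest input integer, i.e., O(1) machine words. *)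
Definition value_bound n (I : instance n) (k : nat) : nat :=
  ((magnitude I).+2 ^ k)%N.

(* Main.v *)
(* By Hall's condition, a set J of jobs is feasible iff p times the number of its
   jobs with u <= r_j and d_j <= v is at most v - u for all u < v; the
   earliest-deadline rule then completes J.  An optimal set splits into blocks,
   during which the machine never idles, each from a release time a to a + g p
   with g jobs.  A dynamic program over the jobs k in order of deadlines computes,
   for all a and g, a heaviest set of g jobs among the first k that fills a block
   [a, a + g p).  If job k belongs to a block, it has the lowest priority there, so
   it runs exactly in the gaps, of total length p, that the other jobs leave between
   r_k and the completion time of k, and this time has the form a + (Q + 1) p.
   After it a new block starts; before it, the other jobs form a chain of blocks
   separated by gaps none of which starts before r_k.  As the total length of the gaps before
   the start r_m of a block of the chain is less than p, the number of jobs before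
   it is determined: it is the quotient of r_m - a by p.  Hence the chain needs a
   table indexed by m only, and each of the O(n^3) entries is a best of O(n)
   candidates, after which O(n) steps copy the corresponding set of jobs.

   All the tables hold sets feasible for a relaxed problem (the set fits into the
   interval, possibly with idle time) that are at least as heavy as every set of
   the exact form above. *)

Require Import Defs.
From mathcomp Require Import all_boot all_order all_algebra.
From mathcomp Require Import finmap.
From mathcomp Require Import zify.

Set Implicit Arguments.
Unset Strict Implicit.
Unset Printing Implicit Defensive.

Import Order.TTheory GRing.Theory Num.Theory.

Local Open Scope ring_scope.

(** * Hall's condition and earliest-deadline schedules *)

Section Scheduling.
Variables (n : nat) (I : instance n).
Implicit Types (J : {set 'I_n}) (S : assignment n) (j : 'I_n).

Local Notation p := (plen I).
Local Notation r := (release I).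
Local Notation d := (deadline I).

Definition demand J (u v : int) : nat :=
  #|[set j in J | (u <= r j) && (d j <= v)]|.

Definition hall J : Prop :=
  forall u v, (0 < demand J u v)%N -> (p * demand J u v)%N%:Z <= v - u.

Lemma card_window (A : {fset int}) (u : int) (L : nat) :
  (forall t, t \in A -> u <= t < u + L%:Z) ->
  (#|` A| = \sum_(i < L) (u + i%:Z \in A)%R)%N.
Proof.
move=> Asub.
pose e := [seq u + i%:Z | i <- iota 0 L].
have e_uniq : uniq e by rewrite map_inj_uniq ?iota_uniq // => i k /=; lia.
have -> : A = [fset t in [seq t <- e | t \in A]]%fset.
  apply/fsetP => t; rewrite inE mem_filter; case: (boolP (t \in A)) => //= tA.
  apply/esym/mapP; have := Asub _ tA => tb.
  by exists `|t - u|%N; rewrite ?mem_iota; lia.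
rewrite card_fseq undup_id ?filter_uniq // size_filter count_map.
rewrite -(big_mkord xpredT
  (fun i => nat_of_bool (u + i%:Z \in [fset t in [seq t <- e | t \in A]]%fset))).
rewrite -sum1_count big_mkcond /index_iota subn0 /=.
rewrite !big_seq; apply: eq_bigr => i; rewrite mem_iota /= add0n => iL.
rewrite inE mem_filter.
suff -> : u + i%:Z \in e by rewrite andbT; case: (_ \in _).
by apply/mapP; exists i; rewrite ?mem_iota.
Qed.

Lemma in_units_before (A : {fset int}) (v t : int) :
  (t \in [fset u in A | (u < v)%R]%fset) = (t \in A) && (t < v).
Proof. by rewrite !inE. Qed.

Lemma schedule_hall S J :
  is_schedule I S -> (forall j, j \in J -> completes I S j) -> hall J.
Proof.
move=> [Swin Sdis] SJ u v; rewrite /demand; set D := [set _ in _ | _] => D0.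
have DP j : j \in D -> [/\ j \in J, u <= r j & d j <= v].
  by rewrite inE => /andP[-> /andP[-> ->]].
have uv : u <= v.
  move: D0; rewrite card_gt0 => /set0Pn[j /DP[jJ ur dv]].
  have /eqP cj := SJ _ jJ.
  have : (0 < #|` S j|)%N by rewrite cj plen_gt0.
  by rewrite cardfs_gt0 => /fset0Pn[t /Swin]; lia.
pose L := `|v - u|%N.
suff : (p * #|D| <= L)%N by rewrite /L; lia.
have -> : (p * #|D| = \sum_(j in D) \sum_(i < L) (u + i%:Z \in S j)%R)%N.
  rewrite mulnC -sum_nat_const; apply: eq_bigr => j /DP[jJ ur dv].
  have /eqP <- := SJ _ jJ.
  by apply: card_window => t /Swin; rewrite /L; lia.
rewrite exchange_big /= -[X in (_ <= X)%N]card_ord -sum1_card.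
apply: leq_sum => i _.
have [j /andP[jD jS]|no] := pickP [pred j | (j \in D) && (u + i%:Z \in S j)].
  rewrite (bigD1 j) //= jS big1 // => k /andP[kD kj].
  apply/eqP; rewrite eqb0; apply/negP => kS.
  by have /fdisjointP/(_ _ kS) := Sdis _ _ kj; rewrite jS.
rewrite big1 // => j jD; apply/eqP; rewrite eqb0.
by have := no j; rewrite /= jD /= => ->.
Qed.

(* The earliest-deadline rule from time t0 on: ran i j counts the units among
   t0, ..., t0 + i - 1 given to j. *)
Section Simulation.
Variables (J : {set 'I_n}) (t0 : int).

Definition waiting (i : nat) (c : 'I_n -> nat) : pred 'I_n :=
  [pred j | [&& j \in J, r j <= t0 + i%:Z & (c j < p)%N]].

Definition runs (i : nat) (c : 'I_n -> nat) : option 'I_n :=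
  omap (fun j0 => [arg min_(j < j0 | waiting i c j) d j]%O)
    [pick j | waiting i c j].

Fixpoint ran (i : nat) : 'I_n -> nat :=
  if i is i'.+1 then fun j => (ran i' j + (runs i' (ran i') == Some j))%N
  else fun=> 0%N.

Let job (i : nat) : option 'I_n := runs i (ran i).

Lemma runs_some i c j : runs i c = Some j ->
  waiting i c j /\ forall k, waiting i c k -> d j <= d k.
Proof.
rewrite /runs; case: pickP => //= j0 w0 [<-].
by case: arg_minP.
Qed.

Lemma runs_none i c j : runs i c = None -> waiting i c j = false.
Proof. by rewrite /runs; case: pickP => //= ->. Qed.

Lemma ran_sum i j : (ran i j = \sum_(k < i) (job k == Some j))%N.
Proof.
elim: i => [|i IH] /=; first by rewrite big_ord0.
by rewrite big_ord_recr /= IH.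
Qed.

Lemma ran_leq i k j : (i <= k)%N -> (ran i j <= ran k j)%N.
Proof.
move=> ik; rewrite -(subnK ik); elim: (k - i)%N => [|e IH] //=.
by rewrite (leq_trans IH) // leq_addr.
Qed.

Lemma ran_max i j : (ran i j <= p)%N.
Proof.
elim: i => [|i IH] //=.
case: eqP => [/runs_some[/and3P[_ _ H] _]|_]; first by rewrite addn1.
by rewrite addn0.
Qed.

Hypothesis Jhall : hall J.
Hypothesis t0_min : forall j, j \in J -> t0 <= r j.

Lemma ran_complete i j : j \in J -> d j <= t0 + i%:Z -> ran i j = p.
Proof.
move=> jJ dji.
have pj := plen_gt0 I.
have hj : r j + p%:Z <= d j.
  have D1 : (0 < demand J (r j) (d j))%N.
    by rewrite card_gt0; apply/set0Pn; exists j; rewrite inE jJ !lexx.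
  by have := Jhall D1; nia.
have t0j := t0_min jJ.
pose v := `|d j - t0|%N.
have dv : d j = t0 + v%:Z by rewrite /v; lia.
suff H : ran v j = p.
  apply/eqP; rewrite eqn_leq ran_max /= -[X in (X <= _)%N]H ran_leq //; lia.
apply/eqP; rewrite eqn_leq ran_max /= leqNgt; apply/negP => jlt.
pose busy k := if job k is Some l then d l <= d j else false.
pose bad u := (u <= v)%N && [forall k : 'I_v, (u <= k)%N ==> busy k].
have exbad : exists u, bad u.
  by exists v; rewrite /bad leqnn; apply/forallP => k; rewrite leqNgt ltn_ord.
case: (ex_minnP exbad) => u /andP[uv /forallP ubusy] umin.
have {}ubusy k : (u <= k)%N -> (k < v)%N -> busy k.
  by move=> uk kv; have := ubusy (Ordinal kv); rewrite /= uk.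
have prev l : l \in J -> d l <= d j -> (ran u l < p)%N -> t0 + u%:Z <= r l.
  move=> lJ dl lu; case: u uv ubusy umin lu => [|u] uv ubusy umin lu.
    by have := t0_min lJ; lia.
  rewrite leNgt; apply/negP => rl.
  have wl : waiting u (ran u) l.
    rewrite /waiting /= lJ (leq_ltn_trans _ lu) ?andbT /= ?leq_addr //; lia.
  suff : bad u by move=> /umin; rewrite ltnn.
  rewrite /bad (ltnW uv); apply/forallP => k; apply/implyP => uk.
  have [ku|] := ltnP u k; first exact: ubusy.
  move=> ku; have -> : k = u :> nat by lia.
  rewrite /busy; case E: (job u) => [m|]; last by rewrite (runs_none _ E) in wl.
  by have [_ /(_ _ wl)] := runs_some E; lia.
have ju : (ran u j < p)%N by rewrite (leq_ltn_trans _ jlt) // ran_leq.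
pose D := [set l in J | (t0 + u%:Z <= r l) && (d l <= d j)].
have jD : j \in D by rewrite inE jJ lexx prev.
have D0 : (0 < demand J (t0 + u%:Z) (d j))%N.
  by rewrite card_gt0; apply/set0Pn; exists j.
have := Jhall D0; rewrite /demand -/D => hD.
suff : (v - u < p * #|D|)%N by lia.
have runD k : (u <= k)%N -> (k < v)%N -> exists2 l, l \in D & job k = Some l.
  move=> uk kv; have := ubusy _ uk kv; rewrite /busy.
  case E: (job k) => [l|] // dl; exists l => //.
  have [/and3P[lJ _ lk] _] := runs_some E.
  by rewrite inE lJ dl andbT prev // (leq_ltn_trans _ lk) // ran_leq.
have inc e : (u + e <= v)%N ->
    (\sum_(l in D) ran (u + e) l = \sum_(l in D) ran u l + e)%N.
  elim: e => [|e IH] ev; first by rewrite !addn0.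
  rewrite addnS /= big_split /= IH; last by lia.
  have [l lD E] := runD (u + e)%N (leq_addr _ _) ltac:(lia).
  rewrite -/(job _) E; suff -> : (\sum_(m in D) (Some l == Some m) = 1)%N by rewrite addn1 addnS.
  rewrite (bigD1 l) //= eqxx big1 // => m /andP[_ ml].
  by apply/eqP; rewrite eqb0; apply: contraNneq ml => -[->].
have := inc (v - u)%N; rewrite subnKC // => /(_ (leqnn _)) sv.
have : (\sum_(l in D) ran v l < \sum_(l in D) p)%N.
  rewrite (bigD1 j) //= [X in (_ < X)%N](bigD1 j) //=.
  rewrite -addSn leq_add // leq_sum // => l _; exact: ran_max.
rewrite sum_nat_const mulnC; lia.
Qed.

Definition horizon : nat := \max_(j in J) `|d j - t0|%N.

Definition edf_assignment : assignment n := fun j =>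
  [fset t in [seq (t0 + i%:Z)%R | i <- iota 0 horizon & job i == Some j]]%fset.

Lemma edf_mem j t : reflect (exists2 i : nat, (i < horizon)%N & t = t0 + i%:Z
  /\ job i = Some j) (t \in edf_assignment j).
Proof.
rewrite inE; apply: (iffP mapP) => [[i]|[i iT [-> ji]]].
  by rewrite mem_filter mem_iota => /andP[/eqP ji iT] ->; exists i.
by exists i; rewrite // mem_filter mem_iota ji eqxx.
Qed.

Lemma edf_ran j (i : nat) : (i <= horizon)%N ->
  #|` [fset u in edf_assignment j | (u < (t0 + i%:Z))%R]%fset| = ran i j.
Proof.
move=> iT; rewrite (@card_window _ t0 i); last first.
  move=> t; rewrite in_units_before => /andP[/edf_mem[k _ [-> _]]]; lia.
rewrite ran_sum; apply: eq_bigr => k _; congr nat_of_bool.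
have kT : (k < horizon)%N by apply: leq_trans iT.
rewrite in_units_before ltrD2l ltz_nat ltn_ord andbT.
apply/edf_mem/eqP => [[l lT [kl <-]]|jk]; last by exists k.
by congr (job _); lia.
Qed.

Lemma job_mem i j : job i = Some j -> j \in J.
Proof. by move=> /runs_some[/and3P[]]. Qed.

Lemma job_in_horizon i j : job i = Some j -> t0 + i%:Z < d j.
Proof.
move=> E; have [/and3P[jJ _ lt] _] := runs_some E.
rewrite ltNge; apply/negP => /(ran_complete jJ) E2.
by rewrite E2 ltnn in lt.
Qed.

Lemma edf_schedule : earliest_deadline_schedule I J edf_assignment.
Proof.
have hor j : j \in J -> d j <= t0 + horizon%:Z.
  move=> jJ; have : (`|d j - t0| <= horizon)%N by apply: (leq_bigmax_cond j jJ).
  lia.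
split.
- split=> [j t /edf_mem[i _ [-> E]]|i j ij].
    rewrite job_in_horizon // andbT.
    by have [/and3P[_ ->]] := runs_some E.
  apply/fdisjointP => t /edf_mem[k _ [-> E]]; apply/negP => /edf_mem[l _ [kl E2]].
  have kl' : k = l by lia.
  by move: E2; rewrite -kl' E => -[/eqP]; apply/negP.
- move=> j jJ; rewrite /completes.
  rewrite -(ran_complete jJ (hor _ jJ)) -edf_ran //.
  apply/eqP; congr (#|` _|); apply/fsetP => t; rewrite in_units_before.
  by case: edf_mem => // -[i iT [-> _]]; lia.
- move=> j; apply: contraNeq => /fset0Pn[t /edf_mem[i _ [_ E]]].
  exact: job_mem E.
- move=> t j jJ /andP[rt]; have := t0_min jJ => t0j.
  pose i := `|t - t0|%N; have -> : t = t0 + i%:Z by rewrite /i; lia.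
  have [iT|iT] := leqP horizon i.
    move=> H; exfalso; have := ran_complete jJ (hor _ jJ).
    rewrite -edf_ran // => E; suff : (p <=
      #|` [fset u in edf_assignment j | (u < (t0 + i%:Z))%R]%fset|)%N by lia.
    rewrite -E; apply: fsubset_leq_card; apply/fsubsetP => u; rewrite !in_units_before.
    by case/andP => -> ?; lia.
  rewrite edf_ran ?(ltnW iT) // => lt.
  have wj : waiting i (ran i) j by rewrite /waiting /= jJ lt andbT /=; rewrite /i; lia.
  case E: (job i) => [k|]; last by rewrite (runs_none _ E) in wj.
  have [wk km] := runs_some E; exists k; split.
  + exact: job_mem E.
  + by apply/edf_mem; exists i.
  + exact: km.
Qed.

End Simulation.

Lemma hall_edf J : hall J -> exists S, earliest_deadline_schedule I J S.
Proof.
move=> hJ; case: (set_0Vmem J) => [->|[j0 j0J]].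
  by exists (fun=> fset0); split=> [|j|//|t i];
    rewrite ?inE //; split=> // i j _; rewrite fdisjoint0X.
case: (@arg_minP _ _ _ j0 (mem J) r j0J) => j1 _ j1min.
by exists (edf_assignment J (r j1)); apply: edf_schedule.
Qed.

Lemma feasibleP J : feasible I J <-> hall J.
Proof.
split=> [[S [S1 S2]]|/hall_edf[S [S1 S2 _ _]]]; last by exists S.
exact: schedule_hall S1 S2.
Qed.

Lemma edf_max_throughput J S : max_weight_feasible I J ->
  earliest_deadline_schedule I J S -> max_throughput I S.
Proof.
move=> [_ Jmax] [S1 S2 S3 _]; split=> // S' S1'.
have -> : throughput I S = set_weight I J.
  apply: eq_bigl => j; apply/idP/idP => [|/S2//].
  apply: contraLR => /S3; rewrite /completes => ->.
  by rewrite cardfs0 neq_ltn plen_gt0.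
have := Jmax [set j | completes I S' j].
rewrite /set_weight (eq_bigl (completes I S')) => [|j]; last by rewrite inE.
by apply; exists S'; split => // j; rewrite inE.
Qed.

(** * Blocks *)

Section Blocks.
Variable dpos : 'I_n -> nat.
Implicit Types (A B : {set 'I_n}) (m : 'I_n) (a b t u v : int) (k g Q q i : nat).

Definition late J u : nat := #|[set j in J | u <= r j]|.
Definition starts J a : Prop := forall j, j \in J -> a <= r j.
Definition below k J : Prop := forall j, j \in J -> (dpos j < k)%N.

(* By Hall's condition, the jobs of J can also be completed by time b. *)
Definition fits J b : Prop :=
  forall u, (0 < late J u)%N -> (p * late J u)%N%:Z <= b - u.

Definition block k a g J : Prop :=
  [/\ hall J, below k J, starts J a & fits J (a + (p * g)%N%:Z)].

Definition best_block k a g J : Prop :=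
  block k a g J /\ forall J', block k a g J' -> #|J'| = g ->
    (set_weight I J' <= set_weight I J)%N.

(* A schedule of Q jobs from time a to time b <= a + (Q + 1) p which leaves
   no gap before time u0. *)
Definition gapped k a Q b u0 J : Prop :=
  [/\ hall J, below k J, starts J a, fits J b &
      forall u, a <= u <= u0 ->
        (p * late J u)%N%:Z <= a + (p * Q)%N%:Z - u].

Definition steady a Q J : Prop :=
  #|J| = Q /\ forall y, (y <= Q)%N -> (late J (a + (p * y)%N%:Z) <= Q - y)%N.

Definition best_gapped k a Q b u0 J : Prop :=
  gapped k a Q b u0 J /\ forall J', gapped k a Q b u0 J' -> steady a Q J' ->
    (set_weight I J' <= set_weight I J)%N.

Lemma late_setU A B u : [disjoint A & B] ->
  (late (A :|: B) u = late A u + late B u)%N.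
Proof.
move=> AB; rewrite /late -cardsUI setIC.
rewrite (_ : _ :&: _ = set0) ?cards0 ?addn0; last first.
  apply/setP => j; rewrite !inE; apply/negP => /andP[/andP[jB _] /andP[jA _]].
  by move: AB; rewrite disjoint_subset => /subsetP/(_ _ jA); rewrite inE jB.
by congr #|pred_of_set _|; apply/setP => j; rewrite !inE andb_orl.
Qed.

Lemma demand_setU A B u v : [disjoint A & B] ->
  (demand (A :|: B) u v = demand A u v + demand B u v)%N.
Proof.
move=> AB; rewrite /demand -cardsUI setIC.
rewrite (_ : _ :&: _ = set0) ?cards0 ?addn0; last first.
  apply/setP => j; rewrite !inE; apply/negP => /andP[/andP[jB _] /andP[jA _]].
  by move: AB; rewrite disjoint_subset => /subsetP/(_ _ jA); rewrite inE jB.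
by congr #|pred_of_set _|; apply/setP => j; rewrite !inE andb_orl.
Qed.

Lemma late_sub A B u : A \subset B -> (late A u <= late B u)%N.
Proof.
move=> /subsetP AB; apply/subset_leq_card/subsetP => j.
by rewrite !inE => /andP[/AB-> ->].
Qed.

Lemma demand_sub A B u v : A \subset B -> (demand A u v <= demand B u v)%N.
Proof.
move=> /subsetP AB; apply/subset_leq_card/subsetP => j.
by rewrite !inE => /andP[/AB-> ->].
Qed.

Lemma demand_late J u v : (demand J u v <= late J u)%N.
Proof.
apply/subset_leq_card/subsetP => j.
by rewrite !inE => /and3P[-> ->].
Qed.

Lemma late_card J u : (late J u <= #|J|)%N.
Proof. by apply/subset_leq_card/subsetP => j; rewrite inE => /andP[]. Qed.

Lemma late_starts J a u : starts J a -> u <= a -> late J u = #|J|.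
Proof.
move=> Ja ua; congr #|pred_of_set _|; apply/setP => j; rewrite inE.
by case: (boolP (j \in J)) => // /Ja; lia.
Qed.

Lemma late_anti J u v : u <= v -> (late J v <= late J u)%N.
Proof.
move=> uv; apply/subset_leq_card/subsetP => j.
by rewrite !inE => /andP[-> /(le_trans uv)].
Qed.

Lemma late_gt0 J u j : j \in J -> u <= r j -> (0 < late J u)%N.
Proof. by move=> jJ uj; rewrite card_gt0; apply/set0Pn; exists j; rewrite inE jJ. Qed.

Lemma late_gt0P J u : (0 < late J u)%N -> exists2 j, j \in J & u <= r j.
Proof.
by rewrite card_gt0 => /set0Pn[j]; rewrite inE => /andP[]; exists j.
Qed.

Lemma hall_sub A B : A \subset B -> hall B -> hall A.
Proof.
move=> AB hB u v dA; have := demand_sub u v AB => dAB.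
have := hB u v (leq_trans dA dAB); have := leq_mul (leqnn p) dAB; lia.
Qed.

Lemma below_sub k A B : A \subset B -> below k B -> below k A.
Proof. by move=> /subsetP AB hB j /AB/hB. Qed.

Lemma starts_sub a A B : A \subset B -> starts B a -> starts A a.
Proof. by move=> /subsetP AB hB j /AB/hB. Qed.

Lemma fits_sub b A B : A \subset B -> fits B b -> fits A b.
Proof.
move=> AB hB u dA; have := late_sub u AB => dAB.
have := hB u (leq_trans dA dAB); have := leq_mul (leqnn p) dAB; lia.
Qed.

Lemma fits_release J b j : fits J b -> j \in J -> r j + p%:Z <= b.
Proof.
move=> fJ jJ; have l0 := late_gt0 jJ (lexx _).
by have := fJ _ l0; have := leq_mul (leqnn p) l0; lia.
Qed.

Lemma fits_disjoint A B b : fits A b -> starts B b -> [disjoint A & B].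
Proof.
move=> fA sB; rewrite disjoint_subset; apply/subsetP => j jA; rewrite inE.
apply/negP => /sB; have := fits_release fA jA; have := plen_gt0 I; lia.
Qed.

Lemma hall_setU A B b : hall A -> fits A b -> hall B -> starts B b ->
  hall (A :|: B).
Proof.
move=> hA fA hB sB u v; rewrite demand_setU ?(fits_disjoint fA sB) //.
have [->|A0] := posnP (demand A u v); first exact: hB.
have [-> _|B0 _] := posnP (demand B u v); first by rewrite addn0; exact: hA.
have Al := demand_late A u v; have l0 := leq_trans A0 Al.
have ub : u <= b.
  have [j jA uj] := late_gt0P l0; have := fits_release fA jA; lia.
have eB : demand B b v = demand B u v.
  congr #|pred_of_set _|; apply/setP => j; rewrite !inE.
  case: (boolP (j \in B)) => //= /sB bj; rewrite bj (le_trans ub bj) //.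
have := hB b v; rewrite eB => /(_ B0); have := fA u l0.
have := leq_mul (leqnn p) Al; rewrite mulnDr; lia.
Qed.

Lemma fits_setU A B b c : fits A b -> fits B c -> starts B b -> b <= c ->
  fits (A :|: B) c.
Proof.
move=> fA fB sB bc u; rewrite late_setU ?(fits_disjoint fA sB) //.
have [->|A0] := posnP (late A u); first exact: fB.
have Ab := fA _ A0; have [-> _|B0 _] := posnP (late B u); first by rewrite addn0; lia.
have ub : u <= b.
  have [j jA uj] := late_gt0P A0; have := fits_release fA jA; lia.
move: Ab (fB b); rewrite (late_starts sB (lexx _)) -(late_starts sB ub) => Ab /(_ B0).
rewrite mulnDr; lia.
Qed.

Lemma starts_setU A B a : starts A a -> starts B a -> starts (A :|: B) a.
Proof. by move=> sA sB j; rewrite inE => /orP[/sA|/sB]. Qed.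

Lemma below_setU A B k : below k A -> below k B -> below k (A :|: B).
Proof. by move=> sA sB j; rewrite inE => /orP[/sA|/sB]. Qed.

Lemma set_weightU A B : [disjoint A & B] ->
  set_weight I (A :|: B) = (set_weight I A + set_weight I B)%N.
Proof.
move=> AB; rewrite /set_weight -bigU //=.
by apply: eq_bigl => j; rewrite inE.
Qed.

Lemma card_fits J a g : starts J a -> fits J (a + (p * g)%N%:Z) ->
  (#|J| <= g)%N.
Proof.
move=> sJ fJ; have := fJ a; rewrite (late_starts sJ (lexx _)).
have [->//|J0] := posnP #|J|; move=> /(_ isT); have := plen_gt0 I; nia.
Qed.

Lemma block_gapped k a Q b u0 B : block k a Q B -> u0 <= a + (p * Q)%N%:Z ->
  a + (p * Q)%N%:Z <= b -> gapped k a Q b u0 B.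
Proof.
move=> [hB kB sB fB] uQ Qb; split=> // [u l0|u].
  by have := fB u l0; lia.
by have [->|/fB] := posnP (late B u); lia.
Qed.

Lemma gapped_setU k a q t u0 i b A B : gapped k a q t u0 A -> block k t i B ->
  a <= t -> t + (p * i)%N%:Z <= b ->
  gapped k a (q + i) b u0 (A :|: B) /\ [disjoint A & B].
Proof.
move=> [hA kA sA fA gA] [hB kB sB fB] at_ tb.
have AB := fits_disjoint fA sB; split=> //; split.
- exact: hall_setU hA fA hB sB.
- exact: below_setU.
- by apply: starts_setU => // j /sB; lia.
- apply: (@fits_setU _ _ t) => // [u /fB|]; nia.
- move=> u uu; rewrite late_setU // !mulnDr.
  have := gA _ uu; have := card_fits sB fB; have := late_card B u; nia.
Qed.

Lemma gapped_steady k a Q b u0 J : gapped k a Q b u0 J ->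
  b < a + (p * Q.+1)%N%:Z -> #|J| = Q -> steady a Q J.
Proof.
move=> [_ _ sJ fJ _] bQ JQ; split=> // y yQ.
have [->//|/fJ] := posnP (late J (a + (p * y)%N%:Z)).
have := plen_gt0 I; nia.
Qed.

(* The last gap ends at a time t maximizing t + p * late J t. *)
Lemma gapped_split k a Q b u0 J :
  gapped k a Q b u0 J -> steady a Q J -> a <= u0 -> b <= a + (p * Q.+1)%N%:Z ->
  block k a Q J \/
  exists m q i A B, [/\ m \in J, (q + i = Q)%N, (0 < i)%N &
    [/\ a + (p * q)%N%:Z < r m < a + (p * q.+1)%N%:Z,
      r m + (p * i)%N%:Z <= b, J = A :|: B & [disjoint A & B]]] /\
    [/\ gapped k a q (r m) u0 A, steady a q A,
      u0 <= a + (p * q)%N%:Z, block k (r m) i B & #|B| = i].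
Proof.
move=> [hJ kJ sJ fJ gJ] [JQ stJ] au0 bQ; have p0 := plen_gt0 I.
case: (set_0Vmem J) => [J0|[j0 j0J]].
  left; split => // u; rewrite J0 /late; rewrite (_ : [set _ in _ | _] = set0) ?cards0 //.
  by apply/setP => j; rewrite !inE.
pose e j := r j + (p * late J (r j))%N%:Z.
case: (@Order.TotalTheory.arg_maxP _ _ _ j0 (mem J) e j0J) => m mJ mmax.
have lateE u : (0 < late J u)%N -> u + (p * late J u)%N%:Z <= e m.
  move=> /late_gt0P[j1 j1J uj1].
  case: (@Order.TotalTheory.arg_minP _ _ _ j1 (fun j => (j \in J) && (u <= r j)) r).
    by rewrite j1J.
  move=> j /andP[jJ uj] jmin; apply: le_trans (mmax _ jJ); rewrite /e.
  suff -> : late J u = late J (r j) by lia.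
  congr #|pred_of_set _|; apply/setP => l; rewrite !inE.
  case: (boolP (l \in J)) => //= lJ; apply/idP/idP => [ul|]; last exact: le_trans.
  by apply: jmin; rewrite lJ.
have mlate := late_gt0 mJ (lexx (r m)).
have eb : e m <= b by have := fJ _ mlate; rewrite /e; lia.
have am := sJ _ mJ.
have [eQ|eQ] := lerP (e m) (a + (p * Q)%N%:Z).
  by left; split=> // u /lateE; lia.
right; pose i := late J (r m); pose B := [set j in J | r m <= r j].
pose A := J :\: B.
have AJ : A \subset J by apply: subsetDl.
have BJ : B \subset J by apply/subsetP => j; rewrite inE => /andP[].
have JE : J = A :|: B by apply/setP => j; rewrite !inE; case: (j \in J); case: (_ <= _).
have AB : [disjoint A & B].
  by apply/pred0P => j; rewrite /= !inE; case: (j \in J); case: (_ <= _).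
have iB : #|B| = i by [].
have iQ : (i <= Q)%N by rewrite -JQ late_card.
have qA : #|A| = (Q - i)%N by rewrite cardsDS // JQ.
have fA : fits A (r m).
  move=> u l0; have uJ := leq_trans l0 (late_sub u AJ).
  have um : u <= r m.
    have [j jA uj] := late_gt0P l0; move: jA; rewrite !inE => /andP[+ jJ].
    by rewrite jJ /=; lia.
  have := lateE u uJ; rewrite JE late_setU // /e -/i.
  have -> : late B u = i.
    rewrite -iB (late_starts _ um) // => j; by rewrite inE => /andP[].
  rewrite mulnDr; lia.
have ieq : (p * i)%N%:Z = e m - r m by rewrite /e -/i; lia.
have fB : fits B (r m + (p * i)%N%:Z).
  move=> u l0; have := lateE u (leq_trans l0 (late_sub u BJ)).
  have := leq_mul (leqnn p) (late_sub u BJ); lia.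
have qp : (p * (Q - i) + p * i = p * Q)%N by rewrite -mulnDr subnK.
have mQ : a + (p * (Q - i))%N%:Z < r m by lia.
have mQ1 : r m < a + (p * (Q - i).+1)%N%:Z.
  rewrite mulnS; have : r m <= a + (p + p * (Q - i))%N%:Z by rewrite mulnS in bQ; lia.
  rewrite le_eqVlt => /orP[/eqP mE|//].
  have := stJ (Q - i).+1; rewrite mulnS -mE -/(late J _) -/i; lia.
have u0m : u0 < r m.
  rewrite ltNge; apply/negP => mu0; have := gJ (r m); rewrite am mu0 -/i => /(_ isT); lia.
have gA : gapped k a (Q - i) (r m) u0 A.
  split=> //; [exact: hall_sub hJ|exact: below_sub kJ|exact: starts_sub sJ|].
  move=> u uu; have := gJ _ uu; rewrite JE late_setU //.
  have -> : late B u = i.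
    rewrite -iB (@late_starts _ (r m)) //; last by lia.
    by move=> j; rewrite inE => /andP[].
  rewrite mulnDr; lia.
exists m, (Q - i)%N, i, A, B; split; split=> //; first exact: subnK.
- by split=> //; lia.
- exact: gapped_steady gA mQ1 qA.
- by have := gA; case=> _ _ _ _ /(_ u0); rewrite au0 lexx => /(_ isT); lia.
- split=> //; [exact: hall_sub hJ|exact: below_sub kJ|].
  by move=> j; rewrite inE => /andP[].
Qed.

Lemma block_setU k1 k2 a g c i t A B : block k1 a c A -> block k2 t i B ->
  (k2 <= k1)%N -> a + (p * c)%N%:Z <= t -> t + (p * i)%N%:Z <= a + (p * g)%N%:Z ->
  block k1 a g (A :|: B) /\ [disjoint A & B].
Proof.
move=> [hA kA sA fA] [hB kB sB fB] k12 at_ tg.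
have {fA} fA : fits A t by move=> u /fA; lia.
have AB := fits_disjoint fA sB; split=> //; split.
- exact: hall_setU hA fA hB sB.
- by apply: below_setU => // j /kB; lia.
- by apply: starts_setU => // j /sB; lia.
- by apply: (@fits_setU _ _ t) => // [u /fB|]; lia.
Qed.

Hypothesis dpos_mono : forall i j : 'I_n, (dpos i < dpos j)%N -> d i <= d j.

Lemma gapped_add j a Q A :
  gapped (dpos j) a Q (a + (p * Q.+1)%N%:Z) (r j) A -> a <= r j ->
  a + (p * Q.+1)%N%:Z <= d j ->
  block (dpos j).+1 a Q.+1 (j |: A) /\ j \notin A.
Proof.
move=> [hA kA sA fA gA] aj jd.
have jA : j \notin A by apply/negP => /kA; rewrite ltnn.
have dis : [disjoint [set j] & A] by rewrite disjoints1.
have gj : a + (p * Q)%N%:Z >= r j by have := gA (r j); rewrite aj lexx => /(_ isT); lia.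
have late1 u : late [set j] u = nat_of_bool (u <= r j).
  case: (boolP (u <= r j)) => uj; [apply: etrans (cards1 j)|apply: etrans (cards0 'I_n)];
    by apply: eq_card => i; rewrite !inE; case: eqP => // ->; rewrite ?uj // (negbTE uj).
have key u : u <= r j -> (p * (late A u).+1)%N%:Z <= a + (p * Q.+1)%N%:Z - u.
  move=> uj; rewrite !mulnS; have [au|ua] := lerP a u.
    by have := gA u; rewrite au uj => /(_ isT); lia.
  by have := gA a; rewrite lexx aj !(late_starts sA) // => [/(_ isT)|]; lia.
split=> //; split.
- move=> u v; rewrite demand_setU // => dg0.
  have [uj|uj] := boolP ((u <= r j) && (d j <= v)); last first.
    have d0 : demand [set j] u v = 0%N.
      apply/eqP; rewrite cards_eq0; apply/eqP/setP => i; rewrite !inE.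
      by case: eqP => // ->; apply/negbTE.
    by move: dg0; rewrite d0; exact: hA.
  have d1 : (demand [set j] u v <= 1)%N.
    by rewrite -(cards1 j); apply/subset_leq_card/subsetP => i; rewrite inE => /andP[].
  have := key u; case/andP: uj => -> jv /(_ isT).
  have : (p * (demand [set j] u v + demand A u v) <= p * (late A u).+1)%N.
    by rewrite leq_mul2l; have := demand_late A u v; lia.
  lia.
- move=> i; rewrite !inE => /orP[/eqP->|/kA]; lia.
- by apply: starts_setU => // i; rewrite inE => /eqP->.
- move=> u; rewrite late_setU // late1.
  case: (boolP (u <= r j)) => [uj _|_]; last exact: fA.
  exact: key.
Qed.

(* When job j, of largest deadline, belongs to J, it completes at time
   a + p * Q.+1, the earliest time after its release by which all the jobs of J
   released so far are completed. *)
Lemma block_split j a g J :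
  (forall l : 'I_n, dpos l = dpos j -> l = j) ->
  block (dpos j).+1 a g J -> #|J| = g ->
  (block (dpos j) a g J) \/
  exists Q A B, [/\ (Q < g)%N, J = j |: (A :|: B), j \notin A :|: B &
    [disjoint A & B]] /\
    [/\ gapped (dpos j) a Q (a + (p * Q.+1)%N%:Z) (r j) A, steady a Q A,
      a <= r j <= a + (p * Q)%N%:Z, a + (p * Q.+1)%N%:Z <= d j &
      (B = set0 /\ Q.+1 = g) \/
      exists2 m, m \in B & [/\ r m = a + (p * Q.+1)%N%:Z,
        block (dpos j) (r m) (g - Q.+1) B & #|B| = (g - Q.+1)%N]].
Proof.
move=> jinj [hJ kJ sJ fJ] Jg; have p0 := plen_gt0 I.
case: (boolP (j \in J)) => jJ; last first.
  left; split=> // i iJ; have := kJ _ iJ; rewrite ltnS leq_eqVlt.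
  by case/orP => // /eqP/jinj ij; rewrite -ij iJ in jJ.
right; have aj := sJ _ jJ.
have jg := fits_release fJ jJ.
pose early u : nat := #|[set i in J | r i < u]|.
have earlyE u : (early u + late J u = g)%N.
  rewrite -Jg -(cardsID [set i | r i < u] J) /early /late.
  by congr (_ + _)%N; apply: eq_card => i; rewrite !inE // -leNgt andbC.
have early_mono u v : u <= v -> (early u <= early v)%N.
  by move=> /(late_anti J); have := earlyE u; have := earlyE v; lia.
pose P c := (r j < a + (p * c)%N%:Z) && (early (a + (p * c)%N%:Z)%R <= c)%N.
have Pg : P g by rewrite /P; have := earlyE (a + (p * g)%N%:Z); lia.
case: (ex_minnP (ex_intro P _ Pg)) => c /andP[cj cE] cmin.
have cg := cmin _ Pg; case: c cj cE cmin cg => [|Q] cj cE cmin cg.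
  by rewrite muln0 in cj; lia.
set C := a + (p * Q.+1)%N%:Z in cj cE *.
have gE : (p * g = p * Q.+1 + p * (g - Q.+1))%N by rewrite -mulnDr subnKC.
pose L := [set i in J | r i < C]; pose B := [set i in J | C <= r i].
have LJ : L \subset J by apply/subsetP => i; rewrite inE => /andP[].
have BJ : B \subset J by apply/subsetP => i; rewrite inE => /andP[].
have jL : j \in L by rewrite inE jJ.
have LB : [disjoint L & B].
  by apply/pred0P => i; rewrite /= !inE ltNge; case: (i \in J); case: (_ <= _).
have JE : J = L :|: B.
  by apply/setP => i; rewrite !inE ltNge; case: (i \in J); case: (_ <= _).
have lateC : late J C = (g - Q.+1)%N.
  have := earlyE C; have [->|/fJ lC] := posnP (late J C); first by lia.
  have : (p * late J C <= p * (g - Q.+1))%N by lia.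
  rewrite leq_pmul2l //; lia.
have Bcard : #|B| = (g - Q.+1)%N by rewrite -lateC.
have Lcard : #|L| = Q.+1 by have := earlyE C; rewrite lateC -/L /early -/L; lia.
have lateL u : u <= C -> (late L u + (g - Q.+1) = late J u)%N.
  move=> uC; rewrite [in late J u]JE late_setU // -Bcard; congr (_ + _)%N.
  by rewrite (@late_starts _ C) // => i; rewrite inE => /andP[].
have fL : fits L C.
  move=> u l0; have uC : u <= C.
    by have [i] := late_gt0P l0; rewrite inE => /andP[_]; lia.
  by have := fJ _ (leq_trans l0 (late_sub u LJ)); rewrite -lateL // mulnDr /C; lia.
pose A := L :\ j.
have AL : A \subset L by apply: subsetDl.
have jA : j \notin A by rewrite !inE eqxx.
have Acard : #|A| = Q by have := cardsD1 j L; rewrite jL Lcard add1n => -[].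
have lateA u : u <= r j -> late L u = (late A u).+1.
  move=> uj; rewrite /late (cardsD1 j) inE jL uj add1n; congr _.+1.
  by apply: eq_card => i; rewrite !inE andbA.
have AB : [disjoint A & B] by apply: disjointWl LB.
have gA : gapped (dpos j) a Q C (r j) A.
  split; [exact: hall_sub (subset_trans AL LJ) hJ| | | |].
  - move=> i iA; have := kJ i (subsetP (subset_trans AL LJ) _ iA).
    rewrite ltnS leq_eqVlt => /orP[/eqP/jinj ij|//].
    by rewrite ij (negbTE jA) in iA.
  - exact: starts_sub (subset_trans AL LJ) sJ.
  - exact: fits_sub AL fL.
  - move=> u /andP[au uj]; have := fL u; rewrite lateA // => /(_ isT).
    by rewrite /C !mulnS; lia.
exists Q, A, B; split; split=> //.
- by rewrite JE -(setD1K jL) setUA.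
- by rewrite !inE eqxx /= jJ -ltNge.
- split=> // y yQ; set u := a + (p * y)%N%:Z.
  have yC : u <= C by rewrite /u /C; have := leq_mul (leqnn p) (leqW yQ); lia.
  clear gE lateC Bcard Pg.
  have [ju|uj] := ltrP (r j) u; last first.
    clear earlyE lateL lateA.
    case: gA => _ _ _ _ /(_ u); rewrite uj /u => /(_ ltac:(lia)).
    have : (p * Q = p * y + p * (Q - y))%N by rewrite -mulnDr subnKC.
    move=> -> H; rewrite -(leq_pmul2l p0); lia.
  have : (y < early u)%N.
    by rewrite ltnNge; apply/negP => yE; have := cmin y; rewrite /P -/u ju yE => /(_ isT); lia.
  by have := late_sub u AL; have := lateL u yC; have := earlyE u; lia.
- case: gA => _ _ _ _ /(_ (r j)); rewrite aj lexx => /(_ isT); lia.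
- have := hall_sub LJ hJ; move=> /(_ a (d j)).
  have -> : demand L a (d j) = Q.+1.
    rewrite -Lcard; apply: eq_card => i; rewrite inE; case: (boolP (i \in L)) => //= iL.
    have iJ := subsetP LJ _ iL; rewrite (sJ _ iJ) /=.
    have := kJ _ iJ; rewrite ltnS leq_eqVlt => /orP[/eqP/jinj->|/dpos_mono//].
    by rewrite lexx.
  by move=> /(_ isT); rewrite /C; lia.
- clear earlyE early_mono cmin cE lateL lateA gA Lcard Acard fL Pg.
  have cg1 : (Q.+1 + (g - Q.+1) = g)%N by apply: subnKC.
  move: (g - Q.+1)%N gE lateC Bcard cg1 => w gE lateC Bcard cg1.
  case: (set_0Vmem B) => [B0|[i0 i0B]]; [left|right].
    by split=> //; move: Bcard; rewrite B0 cards0; lia.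
  have B0 : (0 < #|B|)%N by rewrite card_gt0; apply/set0Pn; exists i0.
  have sB : starts B C by move=> i; rewrite inE => /andP[].
  have fB : fits B (C + (p * w)%N%:Z).
    by apply: (@fits_sub _ _ J) => // u /fJ; rewrite /C gE; lia.
  have [m /andP[mB mC]|no] := pickP [pred m in B | r m < C + 1].
    exists m => //; have -> : r m = C by apply/eqP; rewrite eq_le -ltzD1 mC sB.
    split=> //; split=> //; first exact: hall_sub hJ.
    move=> i iB; have := kJ _ (subsetP BJ _ iB); rewrite ltnS leq_eqVlt.
    case/orP => [/eqP/jinj ij|//]; by move: iB; rewrite ij inE leNgt cj andbF.
  have sB1 : starts B (C + 1).
    by move=> i iB; have := no i; rewrite /= iB; lia.
  by have := fB (C + 1); rewrite (late_starts sB1) // Bcard => /(_ ltac:(lia)); lia.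
Qed.

Lemma chain_split k j J : hall J -> below k J -> starts J (r j) -> j \in J ->
  exists g A B, [/\ (0 < g)%N, J = A :|: B, [disjoint A & B] &
   [/\ block k (r j) g A, #|A| = g & starts B (r j + (p * g)%N%:Z)]].
Proof.
move=> hJ kJ sJ jJ; have p0 := plen_gt0 I; set a := r j in sJ *.
pose early u : nat := #|[set i in J | r i < u]|.
have early_mono u v : u <= v -> (early u <= early v)%N.
  move=> uv; apply/subset_leq_card/subsetP => i; rewrite !inE.
  by case/andP=> -> /lt_le_trans->.
pose P g := (0 < g)%N && (early (a + (p * g)%N%:Z)%R <= g)%N.
have Pn : P #|J|.
  rewrite /P; apply/andP; split; first by rewrite card_gt0; apply/set0Pn; exists j.
  by apply/subset_leq_card/subsetP => i; rewrite inE => /andP[].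
case: (ex_minnP (ex_intro P _ Pn)) => g /andP[g0 gE] gmin {Pn}.
have low x u : (x < g)%N -> a + (p * x)%N%:Z < u -> (x < early u)%N.
  move=> xg xu; have [x0|x0] := posnP x.
    rewrite x0 muln0 addr0 in xu.
    by rewrite x0 card_gt0; apply/set0Pn; exists j; rewrite inE jJ.
  apply: leq_trans (early_mono _ _ (ltW xu)); rewrite ltnNge; apply/negP => xE.
  by have := gmin x; rewrite /P x0 xE => /(_ isT); lia.
have low0 x : (x < g)%N -> (x <= early (a + (p * x)%N%:Z)%R)%N.
  case: x => // x xg; apply: (low x _ (ltnW xg)); rewrite mulnS; lia.
set C := a + (p * g)%N%:Z in gE *.
pose A := [set i in J | r i < C]; pose B := [set i in J | C <= r i].
have JE : J = A :|: B.
  by apply/setP => i; rewrite !inE ltNge; case: (i \in J); case: (_ <= _).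
have AB : [disjoint A & B].
  by apply/pred0P => i; rewrite /= !inE ltNge; case: (i \in J); case: (_ <= _).
have AJ : A \subset J by apply/subsetP => i; rewrite inE => /andP[].
have Ag : #|A| = g.
  apply/eqP; rewrite eqn_leq gE /=.
  rewrite -(prednK g0); apply: low; first by rewrite prednK.
  by rewrite /C -[in X in _ < X](prednK g0) mulnS; lia.
exists g, A, B; split=> //; split=> //; last by move=> i; rewrite inE => /andP[].
split; [exact: hall_sub AJ hJ|exact: below_sub AJ kJ|exact: starts_sub AJ sJ|].
move=> u l0; have [i iA ui] := late_gt0P l0.
have uC : u < C by move: iA; rewrite inE => /andP[_]; lia.
have [ua|au] := lerP u a.
  by have := late_card A u; rewrite Ag -/C; have := leq_mul (leqnn p); nia.
have lE : (early u + late A u = g)%N.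
  rewrite -Ag -(cardsID [set i | r i < u] A) /early /late; congr (_ + _)%N.
    apply: eq_card => l; rewrite !inE andbAC; case: (l \in J) => //=.
    by case: (ltrP (r l) u) => //= /lt_trans->.
  by apply: eq_card => l; rewrite !inE -leNgt andbC.
pose x := (`|(u - a)%R| %/ p)%N.
have xe := divn_eq `|u - a|%N p; have xm := ltn_pmod `|u - a|%N p0.
have ue : u = a + (p * x)%N%:Z + (`|u - a|%N %% p)%N%:Z by rewrite mulnC /x; lia.
have xg : (x < g)%N.
  have : (p * x < p * g)%N by rewrite /C in uC; lia.
  by rewrite ltn_pmul2l.
have [m0|m0] := posnP (`|u - a|%N %% p)%N.
  have := low0 x xg; rewrite m0 addr0 in ue; rewrite -ue /C => H.
  have : (p * x <= p * early u)%N by rewrite leq_mul2l H orbT.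
  have : (p * g = p * early u + p * late A u)%N by rewrite -mulnDr lE.
  lia.
have /(low x) := xg; move=> /(_ u ltac:(lia)) H.
have : (p * x.+1 <= p * early u)%N by rewrite leq_mul2l H orbT.
have : (p * g = p * early u + p * late A u)%N by rewrite -mulnDr lE.
rewrite mulnS /C; lia.
Qed.

End Blocks.
End Scheduling.

(** * Counting programs *)

(* Programs whose only loops run a counter from 0 to n - 1, where n is the value
   of variable 0.  The magnitude of assigned values is bounded statically,
   except for the assignments PSet false, which carry a proof obligation. *)
Inductive prog :=
  | PSkip
  | PSet (static : bool) (x : nat) (e : expr)
  | PStore (a : nat) (e1 e2 : expr)
  | PSeq (c1 c2 : prog)
  | PIf (e : expr) (c1 c2 : prog)
  | PFor (x : nat) (c : prog).

Fixpoint compile (c : prog) : cmd :=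
  match c with
  | PSkip => Skip
  | PSet _ x e => Assign x e
  | PStore a e1 e2 => Write a e1 e2
  | PSeq c1 c2 => Seq (compile c1) (compile c2)
  | PIf e c1 c2 => If e (compile c1) (compile c2)
  | PFor x c =>
      Seq (Assign x (Const 0))
        (While (Op OpLt (Var x) (Var 0))
          (Seq (compile c) (Assign x (Op OpAdd (Var x) (Const 1)))))
  end.

Fixpoint sem (c : prog) (s : state) : state :=
  match c with
  | PSkip => s
  | PSet _ x e => set_var s x (eval s e)
  | PStore a e1 e2 => set_arr s a (eval s e1) (eval s e2)
  | PSeq c1 c2 => sem c2 (sem c1 s)
  | PIf e c1 c2 => if eval s e != 0 then sem c1 s else sem c2 s
  | PFor x c =>
      iteri `|vars s 0|%N (fun i s' => set_var (sem c s') x i.+1%:Z)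
        (set_var s x 0)
  end.

Fixpoint mvars (c : prog) : seq nat :=
  match c with
  | PSkip | PStore _ _ _ => [::]
  | PSet _ x _ => [:: x]
  | PSeq c1 c2 | PIf _ c1 c2 => mvars c1 ++ mvars c2
  | PFor x c => x :: mvars c
  end.

Fixpoint marrs (c : prog) : seq nat :=
  match c with
  | PSkip | PSet _ _ _ => [::]
  | PStore a _ _ => [:: a]
  | PSeq c1 c2 | PIf _ c1 c2 => marrs c1 ++ marrs c2
  | PFor _ c => marrs c
  end.

Definition agree (V A : seq nat) (s s' : state) : Prop :=
  (forall y, y \notin V -> vars s' y = vars s y) /\
  (forall b, b \notin A -> arrs s' b = arrs s b).

Lemma agree_trans V A s1 s2 s3 :
  agree V A s1 s2 -> agree V A s2 s3 -> agree V A s1 s3.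
Proof.
move=> [v12 a12] [v23 a23]; split=> y yV.
  by rewrite v23 ?v12.
by rewrite a23 ?a12.
Qed.

Lemma agree_sub V A V' A' s s' : {subset V <= V'} -> {subset A <= A'} ->
  agree V A s s' -> agree V' A' s s'.
Proof.
move=> VV AA [sv sa]; split=> y yn; first by apply/sv/(contra (VV y)).
by apply/sa/(contra (AA y)).
Qed.

Lemma agree_set_var V A s x v : x \in V -> agree V A s (set_var s x v).
Proof. by move=> xV; split=> // y; rewrite /=; case: eqP => // ->; rewrite xV. Qed.

Lemma iteri_agree (V A : seq nat) (f : nat -> state -> state) s N :
  (forall i s', agree V A s' (f i s')) -> agree V A s (iteri N f s).
Proof.
by move=> fV; elim: N => //= N IH; apply: agree_trans (fV _ _).
Qed.

Lemma sem_agree c s : agree (mvars c) (marrs c) s (sem c s).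
Proof.
elim: c s => [|st x e|a e1 e2|c1 IH1 c2 IH2|e c1 IH1 c2 IH2|x c IH] s //=.
- by apply: agree_set_var; rewrite inE.
- by split=> // b; rewrite inE => /negbTE ba /=; rewrite ba.
- apply: agree_trans (agree_sub _ _ (IH1 s)) (agree_sub _ _ (IH2 _)) => y;
    by rewrite mem_cat => ->; rewrite ?orbT.
- case: ifP => _; [apply: agree_sub (IH1 s)|apply: agree_sub (IH2 s)] => y;
    by rewrite mem_cat => ->; rewrite ?orbT.
- apply: (@agree_trans _ _ _ (set_var s x 0)); first exact/agree_set_var/mem_head.
  apply: iteri_agree => i s'.
  apply: (@agree_trans _ _ _ (sem c s')); last exact/agree_set_var/mem_head.
  by apply: agree_sub (IH s') => // y yV; rewrite inE yV orbT.
Qed.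

Fixpoint time (n : nat) (c : prog) : nat :=
  match c with
  | PSkip => 1
  | PSet _ _ e => (cost e).+1
  | PStore _ e1 e2 => (cost e1 + cost e2).+1
  | PSeq c1 c2 => time n c1 + time n c2
  | PIf e c1 c2 => (cost e + maxn (time n c1) (time n c2)).+1
  | PFor _ c => n * (time n c + 8) + 6
  end.

Fixpoint nesting (c : prog) : nat :=
  match c with
  | PSkip | PSet _ _ _ | PStore _ _ _ => 0
  | PSeq c1 c2 | PIf _ c1 c2 => maxn (nesting c1) (nesting c2)
  | PFor _ c => (nesting c).+1
  end.

Fixpoint time_factor (c : prog) : nat :=
  match c with
  | PSkip => 1
  | PSet _ _ e => (cost e).+1
  | PStore _ e1 e2 => (cost e1 + cost e2).+1
  | PSeq c1 c2 => time_factor c1 + time_factor c2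
  | PIf e c1 c2 => (cost e + (time_factor c1 + time_factor c2)).+1
  | PFor _ c => time_factor c + 14
  end.

Lemma time_bound n c d : (nesting c <= d)%N ->
  (time n c <= time_factor c * maxn n 1 ^ d)%N.
Proof.
set m := maxn n 1; have m0 : (0 < m)%N by rewrite /m; lia.
have nm : (n <= m)%N by rewrite /m; lia.
elim: c d => [|st x e|a e1 e2|c1 IH1 c2 IH2|e c1 IH1 c2 IH2|x c IH] d /=.
1-3: by rewrite leq_pmulr // expn_gt0 m0.
- by rewrite geq_max => /andP[/IH1 h1 /IH2 h2]; rewrite mulnDl leq_add.
- rewrite geq_max => /andP[/IH1 h1 /IH2 h2].
  have : (0 < m ^ d)%N by rewrite expn_gt0 m0.
  move: (m ^ d)%N (time n c1) (time n c2) h1 h2 => M T1 T2 h1 h2 M0.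
  move: (time_factor c1) (time_factor c2) h1 h2 => K1 K2 h1 h2.
  by rewrite mulSn mulnDl mulnDl; nia.
- case: d => // d /IH h; have md : (0 < m ^ d)%N by rewrite expn_gt0 m0.
  rewrite expnS; move: (m ^ d)%N (time n c) (time_factor c) md h => M T K M0 h.
  have h1 : (n * (T + 8) <= m * (K * M + 8))%N by apply: leq_mul => //; lia.
  have h2 : (m <= m * M)%N by rewrite leq_pmulr.
  have e1 : (m * (K * M + 8) = K * (m * M) + m * 8)%N by rewrite mulnDr mulnCA.
  have e2 : ((K + 14) * (m * M) = K * (m * M) + 14 * (m * M))%N by rewrite mulnDl.
  lia.
Qed.

Section Magnitude.
(* Absolute values are bounded by powers of Z: variable x by Z ^ dv x, the
   elements of array a by Z ^ da a, and all intermediate results by Z ^ K. *)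
Variables (dv da : nat -> nat) (K Z : nat).
Hypothesis Z2 : (1 < Z)%N.

Fixpoint degree (e : expr) : nat :=
  match e with
  | Const _ => 0
  | Var x => dv x
  | Read a _ => da a
  | Op o e1 e2 =>
      match o with
      | OpAdd | OpSub => (maxn (degree e1) (degree e2)).+1
      | OpMul => degree e1 + degree e2
      | OpDiv => degree e1
      | OpEq | OpLe | OpLt => 0
      end
  end.

Fixpoint expr_ok (e : expr) : bool :=
  match e with
  | Const z => (`|z| <= 1)%N
  | Var _ => true
  | Read _ e => expr_ok e
  | Op _ e1 e2 => [&& expr_ok e1, expr_ok e2 & (degree e <= K)%N]
  end.

Fixpoint prog_ok (c : prog) : bool :=
  match c with
  | PSkip => true
  | PSet st x e => [&& x != 0%N, expr_ok e & st ==> (degree e <= dv x)%N]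
  | PStore a e1 e2 => [&& expr_ok e1, expr_ok e2 & (degree e2 <= da a)%N]
  | PSeq c1 c2 => prog_ok c1 && prog_ok c2
  | PIf e c1 c2 => [&& expr_ok e, prog_ok c1 & prog_ok c2]
  | PFor x c => [&& x != 0%N, x \notin mvars c, (0 < dv x < K)%N & prog_ok c]
  end.

Fixpoint bounds_ok (c : prog) (s : state) : Prop :=
  match c with
  | PSkip | PStore _ _ _ => True
  | PSet st x e => ~~ st -> (`|eval s e|%N <= Z ^ dv x)%N
  | PSeq c1 c2 => bounds_ok c1 s /\ bounds_ok c2 (sem c1 s)
  | PIf e c1 c2 =>
      if eval s e != 0 then bounds_ok c1 s else bounds_ok c2 s
  | PFor x c =>
      forall i, (i < `|vars s 0|)%N ->
        bounds_ok c (iteri i (fun i s' => set_var (sem c s') x i.+1%:Z)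
                    (set_var s x 0))
  end.

Definition bounded (s : state) : Prop :=
  (forall x, (`|vars s x|%N <= Z ^ dv x)%N) /\
  (forall a i, (`|arrs s a i|%N <= Z ^ da a)%N).

Lemma eval_bounded s e : bounded s -> expr_ok e ->
  (`|eval s e|%N <= Z ^ degree e)%N /\ within (Z ^ K) s e.
Proof.
move=> [sv sa]; elim: e => [z|x|a e IH|o e1 IH1 e2 IH2] /=.
- by rewrite expn0.
- by [].
- by move=> /IH[_ ->]; split.
- case/and3P=> /IH1[b1 ->] /IH2[b2 ->] dK /=.
  suff H : (`|eval_op o (eval s e1) (eval s e2)|%N <= Z ^ degree (Op o e1 e2))%N.
    by split=> //; apply: leq_trans H _; rewrite leq_pexp2l //; lia.
  have bool1 (b : bool) : (`|b%:Z| <= Z ^ 0)%N by case: b; rewrite expn0.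
  have max_bound : (`|eval s e1| + `|eval s e2| <=
      Z ^ (maxn (degree e1) (degree e2)).+1)%N.
    rewrite expnS; have h1 : (Z ^ degree e1 <= Z ^ maxn (degree e1) (degree e2))%N.
      by rewrite leq_pexp2l ?leq_maxl; lia.
    have h2 : (Z ^ degree e2 <= Z ^ maxn (degree e1) (degree e2))%N.
      by rewrite leq_pexp2l ?leq_maxr; lia.
    nia.
  case: o {dK} => /=; try exact: bool1.
  + by apply: leq_trans max_bound; lia.
  + by apply: leq_trans max_bound; lia.
  + by rewrite abszM expnD leq_mul.
  + apply: leq_trans b1; exact: lez_div.
Qed.

Lemma bounded_set_var s x v : bounded s -> (`|v| <= Z ^ dv x)%N ->
  bounded (set_var s x v).
Proof.
by move=> [sv sa] vx; split=> // y /=; case: eqP => // ->.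
Qed.

Lemma exec_sem c s n : prog_ok c -> bounded s -> vars s 0 = n%:Z -> (n <= Z)%N ->
  bounds_ok c s ->
  [/\ bounded (sem c s), vars (sem c s) 0 = n%:Z &
   exists2 t, exec (Z ^ K) (compile c) s t (sem c s) & (t <= time n c)%N].
Proof.
move=> + + + nZ.
elim: c s => [|st x e|a e1 e2|c1 IH1 c2 IH2|e c1 IH1 c2 IH2|x c IH] s /=.
- by move=> _ bs s0 _; split=> //; exists 1%N => //; apply: ExecSkip.
- case/and3P=> x0 eok stx bs s0 xb; have [eb ew] := eval_bounded bs eok.
  have {}xb : (`|eval s e| <= Z ^ dv x)%N.
    case: st stx xb => /= [dx _|_]; last exact.
    by apply: leq_trans eb _; rewrite leq_pexp2l //; lia.
  split; first exact: bounded_set_var; first by rewrite /= eq_sym (negbTE x0).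
  by exists (cost e).+1 => //; apply: ExecAssign.
- case/and3P=> e1ok e2ok dax bs s0 _.
  have [_ e1w] := eval_bounded bs e1ok; have [e2b e2w] := eval_bounded bs e2ok.
  split=> //; last by exists (cost e1 + cost e2).+1 => //; apply: ExecWrite.
  case: (bs) => sv sa; split=> // b j /=.
  case: ifP => // /andP[/eqP-> _].
  by apply: leq_trans e2b _; rewrite leq_pexp2l //; lia.
- case/andP=> ok1 ok2 bs s0 [b1 b2].
  have [bs1 s10 [t1 E1 T1]] := IH1 _ ok1 bs s0 b1.
  have [bs2 s20 [t2 E2 T2]] := IH2 _ ok2 bs1 s10 b2.
  by split=> //; exists (t1 + t2)%N; [apply: ExecSeq E1 E2|apply: leq_add].
- case/and3P=> eok ok1 ok2 bs s0; have [_ ew] := eval_bounded bs eok.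
  case: ifP => [e0 b1|/negbFE/eqP e0 b2].
    have [bs1 s10 [t1 E1 T1]] := IH1 _ ok1 bs s0 b1.
    split=> //; exists (cost e + t1).+1; first exact: ExecIfTrue.
    rewrite ltnS leq_add2l; lia.
  have [bs2 s20 [t2 E2 T2]] := IH2 _ ok2 bs s0 b2.
  split=> //; exists (cost e + t2).+1; first exact: ExecIfFalse.
  rewrite ltnS leq_add2l; lia.
- case/and4P=> x0 xc /andP[dx dxK] cok bs s0; rewrite s0 absz_nat => bo.
  pose st i := iteri i (fun i s' => set_var (sem c s') x i.+1%:Z) (set_var s x 0).
  have ZK : (Z <= Z ^ dv x)%N by rewrite -[X in (X <= _)%N]expn1 leq_pexp2l; lia.
  have ZK' : (Z ^ dv x + Z ^ dv x <= Z ^ K)%N.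
    apply: (@leq_trans (Z ^ (dv x).+1)); last by rewrite leq_pexp2l; lia.
    rewrite expnS; nia.
  have inv i : (i <= n)%N -> [/\ bounded (st i), vars (st i) 0 = n%:Z &
      vars (st i) x = i%:Z].
    elim: i => [_|i IHi iN] /=.
      split; rewrite ?eqxx //; last by rewrite eq_sym (negbTE x0).
      by apply: bounded_set_var => //; rewrite absz0.
    have [bi i0 ix] := IHi (ltnW iN).
    have [bi' i0' _] := IH _ cok bi i0 (bo _ iN).
    split; rewrite ?eqxx //; last by rewrite eq_sym (negbTE x0).
    by apply: bounded_set_var => //; rewrite absz_nat; lia.
  have [bn n0 nx] := inv n (leqnn _); split=> //.
  set W := While _ _.
  have loop e i : (i + e = n)%N -> exists2 t, exec (Z ^ K) W (st i) t (st n) &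
      (t <= e * (time n c + 8) + 4)%N.
    elim: e i => [|e IHe] i ie.
      have [bi i0 ix] := inv i ltac:(lia).
      have -> : st n = st i by congr st; lia.
      exists 4%N => //; apply: ExecWhileFalse => //=; rewrite i0 ix;
        by rewrite (_ : (_ < _) = false) ?absz0 //; apply/negbTE; lia.
    have [bi i0 ix] := inv i ltac:(lia).
    have [t2 E2 T2] := IHe i.+1 ltac:(lia).
    have [bi' i0' [t1 E1 T1]] := IH _ cok bi i0 (bo i ltac:(lia)).
    exists (3 + (t1 + 4) + t2).+1; last by rewrite mulSn; lia.
    apply: (@ExecWhileTrue _ _ (st i.+1)) => //.
    + by rewrite /= i0 ix; case: (_ < _); lia.
    + by rewrite /= i0 ix (_ : i%:Z < n%:Z) //; lia.
    + apply: ExecSeq E1 _.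
      have -> : st i.+1 = set_var (sem c (st i)) x
          (eval (sem c (st i)) (Op OpAdd (Var x) (Const 1))).
        rewrite /= (proj1 (sem_agree c (st i))) // ix; congr set_var; lia.
      apply: ExecAssign => /=.
      by have := bi'.1 x; lia.
  have [t E T] := loop n 0%N (add0n _).
  exists (2 + t)%N; last by lia.
  by apply: ExecSeq E; apply: ExecAssign.
Qed.

Lemma sem_for (Inv : nat -> state -> Prop) x c s n :
  x != 0%N -> 0%N \notin mvars c -> x \notin mvars c -> vars s 0 = n%:Z ->
  Inv 0%N (set_var s x 0) ->
  (forall i s', (i < n)%N -> agree (x :: mvars c) (marrs c) s s' ->
    vars s' x = i%:Z -> Inv i s' ->
    bounds_ok c s' /\ Inv i.+1 (set_var (sem c s') x i.+1%:Z)) ->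
  bounds_ok (PFor x c) s /\ Inv n (sem (PFor x c) s).
Proof.
move=> x0 c0 xc s0 I0 IS; rewrite /= s0 absz_nat.
pose st i := iteri i (fun i s' => set_var (sem c s') x i.+1%:Z) (set_var s x 0).
suff H i : (i <= n)%N -> [/\ (forall j, (j < i)%N -> bounds_ok c (st j)),
    agree (x :: mvars c) (marrs c) s (st i), vars (st i) x = i%:Z & Inv i (st i)].
  by have [] := H n (leqnn _).
elim: i => [_|i IH iN] /=.
  by split=> //=; [apply/agree_set_var/mem_head|rewrite eqxx].
have [b a ix Ii] := IH (ltnW iN); have [bi Ii'] := IS _ _ iN a ix Ii.
split=> //; last by rewrite eqxx.
  by move=> j; rewrite ltnS leq_eqVlt => /orP[/eqP->|/b].
apply: agree_trans a _; apply: (@agree_trans _ _ _ (sem c (st i))).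
  by apply: agree_sub (sem_agree _ _) => // y yc; rewrite inE yc orbT.
exact/agree_set_var/mem_head.
Qed.

End Magnitude.

(** * The algorithm *)

Declare Scope prog_scope.
Delimit Scope prog_scope with P.
Local Notation "e1 + e2" := (Op OpAdd e1 e2) : prog_scope.
Local Notation "e1 - e2" := (Op OpSub e1 e2) : prog_scope.
Local Notation "e1 * e2" := (Op OpMul e1 e2) : prog_scope.
Local Notation "e1 %/ e2" := (Op OpDiv e1 e2) : prog_scope.
Local Notation "e1 == e2" := (Op OpEq e1 e2) : prog_scope.
Local Notation "e1 <= e2" := (Op OpLe e1 e2) : prog_scope.
Local Notation "e1 < e2" := (Op OpLt e1 e2) : prog_scope.
Local Notation "c1 ;; c2" := (PSeq c1 c2)
  (at level 95, right associativity) : prog_scope.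
Local Notation "x ::= e" := (PSet true x e%P) (at level 90) : prog_scope.
Local Notation "x :?= e" := (PSet false x e%P) (at level 90) : prog_scope.
Local Notation "'#' z" := (Const z) (at level 2) : prog_scope.
Local Notation V := Var.
Local Notation Rd := Read.

Lemma bool_neq0 (b : bool) : (b%:Z != 0) = b.
Proof. by case: b. Qed.

Lemma boolM (b c : bool) : b%:Z * c%:Z = (b && c)%:Z.
Proof. by case: b; case: c. Qed.

Lemma boolD_neq0 (b c : bool) : (b%:Z + c%:Z != 0) = b || c.
Proof. by case: b; case: c. Qed.

Section Ranks.
Variables (n : nat) (key : nat -> int).

Definition key_lt (i j : nat) : bool :=
  (key i < key j) || (key i == key j) && (i < j)%N.

Definition rank (j : nat) : nat := \sum_(i < n) key_lt i j.

Lemma key_lt_trans i j k : key_lt i j -> key_lt j k -> key_lt i k.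
Proof. rewrite /key_lt; lia. Qed.

Lemma rank_lt i j : (i < n)%N -> key_lt i j -> (rank i < rank j)%N.
Proof.
move=> iN ij; rewrite /rank (bigD1 (Ordinal iN)) //= [X in (_ < X)%N](bigD1 (Ordinal iN)) //=.
rewrite ij (_ : key_lt i i = false); last by rewrite /key_lt; lia.
rewrite add0n add1n ltnS; apply: leq_sum => k _.
by case: (boolP (key_lt k i)) => // /key_lt_trans /(_ ij) ->.
Qed.

Lemma rank_inj i j : (i < n)%N -> (j < n)%N -> rank i = rank j -> i = j.
Proof.
move=> iN jN E; apply/eqP/negPn/negP => ij.
have [/(rank_lt iN)|/(rank_lt jN)] : key_lt i j \/ key_lt j i.
- by rewrite /key_lt; case: (ltrgtP (key i) (key j)); lia.
- by rewrite E ltnn.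
- by rewrite E ltnn.
Qed.

Lemma rank_max j : (j < n)%N -> (rank j < n)%N.
Proof.
move=> jN; rewrite /rank (bigD1 (Ordinal jN)) //= (_ : key_lt j j = false);
  last by rewrite /key_lt; lia.
rewrite add0n -[X in (_ < X)%N]card_ord -sum1_card [X in (_ < X)%N](bigD1 (Ordinal jN)) //=.
by rewrite add1n ltnS; apply: leq_sum => k _; case: (key_lt _ _).
Qed.

Lemma rank_mono i j : (j < n)%N -> (rank i < rank j)%N -> key i <= key j.
Proof.
move=> jN ij; rewrite leNgt; apply/negP => ji.
have /(rank_lt jN) : key_lt j i by rewrite /key_lt ji.
by rewrite ltnNge (ltnW ij).
Qed.
End Ranks.

(* Sorting by counting: i is stored at its rank. *)
Definition sort_prog (ka da : nat) : prog :=
  PFor 2 (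
    4 ::= #0;;
    PFor 3 (
      PIf ((Rd ka (V 3) < Rd ka (V 2)) +
           (Rd ka (V 3) == Rd ka (V 2)) * (V 3 < V 2))
        (4 :?= V 4 + #1) PSkip);;
    PStore da (V 4) (V 2))%P.

Section Run.
Variables (dv : nat -> nat) (Z : nat).
Notation bounds_ok := (bounds_ok dv Z).

Lemma sort_spec ka da n s :
  (1 < Z)%N -> (n <= Z)%N -> (0 < dv 4)%N -> ka != da -> vars s 0 = n%:Z ->
  bounds_ok (sort_prog ka da) s /\
  forall x, (x < n)%N ->
    arrs (sem (sort_prog ka da) s) da
      (rank n (fun i => arrs s ka i%:Z) x)%:Z = x%:Z.
Proof.
move=> Z1 nZ dv4 kad s0; set key := fun i => _.
have ZZ : (Z <= Z ^ dv 4)%N by rewrite -[X in (X <= _)%N]expn1 leq_pexp2l //; lia.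
apply: (sem_for (n := n) (Inv := fun i s' => forall x, (x < i)%N ->
  arrs s' da (rank n key x)%:Z = x%:Z)) => // i s1 iN a1 i1 I1.
set body := PFor 3 _.
have s10 : vars s1 0 = n%:Z by rewrite -s0; apply: a1.1.
have keyE x : arrs s1 ka x%:Z = key x by rewrite a1.2 // inE.
have [b2 I2] : bounds_ok body (set_var s1 4 0) /\
   vars (sem body (set_var s1 4 0)) 4 = (rank n key i)%:Z.
  apply: (sem_for (Inv := fun k s' => vars s' 4 = (\sum_(j < k) key_lt key j i)%N%:Z)) => //=.
    by rewrite big_ord0.
  move=> k s2 kN a2 k2 I2.
  have i2 : vars s2 2 = i%:Z by rewrite a2.1.
  have aE x : arrs s2 ka x%:Z = key x by rewrite a2.2 // keyE.
  rewrite k2 i2 !aE boolM boolD_neq0 ltz_nat big_ord_recr /=.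
  have <- : key_lt key k i = (key k < key i) || (key k == key i) && (k < i)%N by [].
  have le : (\sum_(j < k) key_lt key j i <= k)%N.
    rewrite -[X in (_ <= X)%N]card_ord -sum1_card; apply: leq_sum => j _.
    by case: key_lt.
  move: (\sum_(j < k) _)%N le I2 => c le I2.
  case: (key_lt key k i); rewrite /= I2 ?addn0 //.
  by split=> [_|]; lia.
have a2 : agree [:: 3; 4]%N [::] (set_var s1 4 0) (sem body (set_var s1 4 0)).
  exact: sem_agree body _.
clearbody body; split; first by [].
rewrite /= I2; move: (sem body _) a2 => s2 a2 x xi.
have -> : vars s2 2 = i%:Z by rewrite a2.1.
rewrite eqxx /= eqz_nat.
have [xr|xr] := eqVneq.
  by congr Posz; apply: (@rank_inj n key) => //; lia.
rewrite a2.2 //= I1 //; move: xi; rewrite ltnS leq_eqVlt => /orP[/eqP xi|//].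
by rewrite xi eqxx in xr.
Qed.

Variables (n : nat) (I : instance n).
Implicit Types (J X : {set 'I_n}) (T TA TB TD : nat).

(* Table T consists of array T, which holds weights, and array T.+1, which holds
   the indicators of the corresponding sets, n entries per set. *)
Definition cell (s : state) (T i : nat) J : Prop :=
  arrs s T i%:Z = (set_weight I J)%:Z /\
  forall j : 'I_n, arrs s T.+1 (i * n + j)%N%:Z = (j \in J)%:Z.

Definition apart T T' : bool :=
  (T == T') || [&& T != T', T.+1 != T' & T != T'.+1].

Definition keeps TD dst (s s' : state) : Prop :=
  forall T i J, apart T TD -> (T = TD -> i <> dst) ->
    cell s T i J -> cell s' T i J.

Lemma keeps_trans TD dst s1 s2 s3 :
  keeps TD dst s1 s2 -> keeps TD dst s2 s3 -> keeps TD dst s1 s3.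
Proof. by move=> k1 k2 T i J TT id c; apply: k2 => //; apply: k1. Qed.

Lemma cell_arrs s s' T i J : arrs s' T = arrs s T -> arrs s' T.+1 = arrs s T.+1 ->
  cell s T i J -> cell s' T i J.
Proof. by move=> E1 E2 [c1 c2]; split=> [|j]; rewrite ?E1 ?E2. Qed.

Lemma cell_agree V A s s' T i J : agree V A s s' -> T \notin A -> T.+1 \notin A ->
  cell s T i J -> cell s' T i J.
Proof. by move=> [_ E] TA T1A; apply: cell_arrs; apply: E. Qed.

Lemma sem_seq c1 c2 s : sem (c1;; c2)%P s = sem c2 (sem c1 s).
Proof. by []. Qed.

Lemma bounds_seq c1 c2 s :
  bounds_ok (c1;; c2)%P s = (bounds_ok c1 s /\ bounds_ok c2 (sem c1 s)).
Proof. by []. Qed.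

Lemma wp_seq (P : state -> Prop) c1 c2 s : bounds_ok c1 s ->
  bounds_ok c2 (sem c1 s) /\ P (sem c2 (sem c1 s)) ->
  bounds_ok (c1;; c2)%P s /\ P (sem (c1;; c2)%P s).
Proof. by move=> b1 [b2 p2]. Qed.

Lemma sem_if e c1 c2 s :
  sem (PIf e c1 c2) s = if eval s e != 0 then sem c1 s else sem c2 s.
Proof. by []. Qed.

Lemma bounds_if e c1 c2 s : bounds_ok (PIf e c1 c2) s =
  if eval s e != 0 then bounds_ok c1 s else bounds_ok c2 s.
Proof. by []. Qed.

Definition fill_prog TD (w e : expr) : prog :=
  (PStore TD (V 16) w;;
   PFor 6 (PStore TD.+1 (V 16 * V 0 + V 6) e))%P.

Lemma fill_spec TD w e s dst J :
  vars s 0 = n%:Z -> vars s 16 = dst%:Z -> eval s w = (set_weight I J)%:Z ->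
  (forall s' (j : 'I_n), (forall y, y != 6%N -> vars s' y = vars s y) ->
     vars s' 6 = j%:Z -> keeps TD dst s s' -> eval s' e = (j \in J)%:Z) ->
  let s' := sem (fill_prog TD w e) s in
  [/\ bounds_ok (fill_prog TD w e) s, cell s' TD dst J & keeps TD dst s s'].
Proof.
move=> s0 s16 we ee; rewrite /fill_prog; set c := PFor _ _.
set s1 := set_arr s TD (eval s (V 16)) (eval s w).
have k1 : keeps TD dst s s1.
  move=> T i L TT id [c1 c2]; split=> [|j]; rewrite /s1 /= s16.
    case: ifP => // /andP[/eqP TE /eqP]; have := id TE; lia.
  case: ifP => // /andP[/eqP TE _].
  by move: TT; rewrite /apart -TE; lia.
have [] : bounds_ok c s1 /\ (arrs (sem c s1) TD dst%:Z = (set_weight I J)%:Z /\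
    (forall j : 'I_n, (j < n)%N -> arrs (sem c s1) TD.+1 (dst * n + j)%N%:Z = (j \in J)%:Z) /\
    keeps TD dst s (sem c s1)).
  apply: (sem_for (Inv := fun k s2 => arrs s2 TD dst%:Z = (set_weight I J)%:Z /\
    (forall j : 'I_n, (j < k)%N -> arrs s2 TD.+1 (dst * n + j)%N%:Z = (j \in J)%:Z) /\
    keeps TD dst s s2)) => //.
    split; first by rewrite /= s16 !eqxx we.
    by split.
  move=> k s2 kN [a2 _] k2 [wE [bE kp]]; split=> //.
  have v2 y : y != 6%N -> vars s2 y = vars s y by move=> y6; apply: a2; rewrite /= inE.
  have eE := ee s2 (Ordinal kN) v2 k2 kp.
  rewrite /= (v2 16%N) // (v2 0%N) // s16 s0 k2 eE.
  split; first by rewrite (_ : (TD == TD.+1) = false) ?wE //; apply/negbTE; lia.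
  split.
    move=> j jk; rewrite eqxx /=; case: ifP => [/eqP E|/eqP E].
      by have -> : j = Ordinal kN by apply: val_inj => /=; lia.
    apply: bE; have : (j != k :> nat) by apply/eqP => jk'; apply: E; rewrite jk'; lia.
    by move: jk; rewrite ltnS leq_eqVlt => /orP[->|].
  move=> T i L TT id /(kp T i L TT id)[c1 c2]; split=> [|j] /=.
    by case: ifP => // /andP[/eqP TE _]; move: TT; rewrite /apart TE; lia.
  case: ifP => // /andP[/eqP [TE] /eqP E]; have := id TE; have := ltn_ord j; nia.
by move=> b [wE [bE kp]]; split=> //; split=> // j; apply: bE.
Qed.

(* Registers: 5 candidate, 7 best weight so far, 8 and 9 the sources of the best
   candidate (8 is -1 as long as there is none), 10 weight of the candidate,
   11 and 12 its sources, 13 whether it is valid, 14 and 15 an additional job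
   (or -1) and its weight, 16 destination. *)
Definition best_step (pre : prog) TA TB : prog :=
  (pre;;
   PIf (V 13)
     (10 :?= Rd TA (V 11) + Rd TB (V 12) + V 15;;
      PIf (V 7 < V 10) (7 ::= V 10;; 8 ::= V 11;; 9 ::= V 12) PSkip)
     PSkip)%P.

Definition best_prog (pre : prog) TA TB TD : prog :=
  (8 ::= #(-1);;
   PFor 5 (best_step pre TA TB);;
   PIf (#0 <= V 8)
     (fill_prog TD (V 7)
        (#0 < Rd TA.+1 (V 8 * V 0 + V 6) + Rd TB.+1 (V 9 * V 0 + V 6) +
              (V 6 == V 14)))
     PSkip)%P.

Definition pre_vars : seq nat := [:: 11; 12; 13; 23; 26; 27].
Definition scratch : seq nat := [:: 5, 7, 8, 9, 10 & pre_vars].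

Lemma best_spec pre TA TB TD s dst X ok ia ib SA SB :
  (forall J, (set_weight I J <= Z ^ dv 10)%N) ->
  all (mem pre_vars) (mvars pre) ->
  marrs pre = [::] -> apart TA TD -> apart TB TD ->
  vars s 0 = n%:Z -> vars s 16 = dst%:Z -> vars s 15 = (set_weight I X)%:Z ->
  (forall j : 'I_n, (j \in X) = (j%:Z == vars s 14)) ->
  (forall m s', (m < n)%N -> agree scratch [::] s s' ->
     vars s' 5 = m%:Z ->
     [/\ bounds_ok pre s', (vars (sem pre s') 13 != 0) = ok m &
         ok m -> vars (sem pre s') 11 = (ia m)%:Z /\ vars (sem pre s') 12 = (ib m)%:Z]) ->
  (forall m, (m < n)%N -> ok m ->
     [/\ cell s TA (ia m) (SA m), cell s TB (ib m) (SB m),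
         [disjoint SA m & SB m] & [disjoint X & SA m :|: SB m]]) ->
  (forall m, (m < n)%N -> ok m ->
     (TA = TD -> ia m <> dst) /\ (TB = TD -> ib m <> dst)) ->
  let wt m := (set_weight I (X :|: (SA m :|: SB m)))%:Z in
  let s' := sem (best_prog pre TA TB TD) s in
  [/\ bounds_ok (best_prog pre TA TB TD) s, keeps TD dst s s' &
    (exists m, [/\ (m < n)%N, ok m, cell s' TD dst (X :|: (SA m :|: SB m)),
       vars s 7 < wt m & forall m', (m' < n)%N -> ok m' -> wt m' <= wt m]) \/
    (forall m, (m < n)%N -> ok m -> wt m <= vars s 7) /\ forall b, arrs s' b = arrs s b].
Proof.
move=> wZ fresh noarr TAD TBD s0 s16 s15 s14 Hpre Hcell Halias wt.
pose s1 := set_var s 8 (-1).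
set body := best_step pre TA TB; set c := PFor 5 body.
have premem y : y \in mvars pre -> y \in pre_vars by move=> yin; exact: (allP fresh y yin).
have premem' y : y \notin pre_vars -> y \notin mvars pre.
  by apply: contra; exact: premem.
have mvb : mvars body = mvars pre ++ [:: 10; 7; 8; 9]%N by rewrite /body /best_step /= ?cats0.
have mab : marrs body = [::] by rewrite /body /best_step /= noarr.
have bodymem y : y \in 5%N :: mvars body -> y \in scratch.
  rewrite mvb inE mem_cat => /or3P[/eqP->//|/premem|]; rewrite !inE.
    by move=> ->; rewrite !orbT.
  by case/or4P=> /eqP->.
have bodymem' y : y \notin scratch -> y \notin mvars body.
  by apply: contra => yb; apply: bodymem; rewrite inE yb orbT.
pose found k (s2 : state) := exists m, [/\ (m < k)%N, ok m,
  [/\ vars s2 8 = (ia m)%:Z, vars s2 9 = (ib m)%:Z & vars s2 7 = wt m],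
  vars s 7 < wt m & forall m', (m' < k)%N -> ok m' -> wt m' <= wt m].
pose none k (s2 : state) := [/\ vars s2 8 = -1, vars s2 7 = vars s 7 &
  forall m, (m < k)%N -> ok m -> wt m <= vars s 7].
have [bc inv] : bounds_ok c s1 /\ (found n (sem c s1) \/ none n (sem c s1)).
  apply: (sem_for (Inv := fun k s2 => found k s2 \/ none k s2)) => //.
  - exact: bodymem'.
  - by rewrite mvb mem_cat negb_or premem'.
  - by right; split.
  move=> k s2 kN a2 k2 I2.
  have ag : agree scratch [::] s s2.
    apply: (@agree_trans _ _ _ s1); first exact: agree_set_var.
    by rewrite mab in a2; apply: agree_sub a2.
  have [bp okE okV] := Hpre k s2 kN ag k2.
  have ap := sem_agree pre s2; rewrite noarr in ap.
  rewrite /body /best_step /=.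
  move: (sem pre s2) ap okE okV => s3 ap okE okV.
  have v3 y : y \notin pre_vars -> vars s3 y = vars s2 y.
    by move=> /premem' yp; apply: ap.1.
  have e7 : vars s3 7 = vars s2 7 by apply: v3.
  have e8 : vars s3 8 = vars s2 8 by apply: v3.
  have e9 : vars s3 9 = vars s2 9 by apply: v3.
  have [k_ok|k_ok] := boolP (ok k); rewrite okE ?(negbTE k_ok) ?k_ok; last first.
    split=> //; case: I2 => [[m [mk mok [m8 m9 m7] mlt mmax]]|[n8 n7 nle]]; [left|right].
      exists m; split=> //=; [exact: ltnW|by rewrite e8 e9 e7|].
      move=> m'; rewrite ltnS leq_eqVlt => /orP[/eqP->|/mmax//].
      by rewrite (negbTE k_ok).
    split=> /=; rewrite ?e8 ?e7 //.
    move=> m'; rewrite ltnS leq_eqVlt => /orP[/eqP->|/nle//].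
    by rewrite (negbTE k_ok).
  have [ia3 ib3] := okV k_ok.
  have [[wA _] [wB _] disj Xdisj] := Hcell k kN k_ok.
  have aE b : arrs s3 b = arrs s b by rewrite ap.2 // ag.2.
  have vE : arrs s3 TA (vars s3 11) + arrs s3 TB (vars s3 12) + vars s3 15 = wt k.
    rewrite ia3 ib3 !aE wA wB v3 // ag.1 // s15 /wt !set_weightU //; lia.
  have wtZ : (`|wt k| <= Z ^ dv 10)%N by rewrite /wt absz_nat.
  rewrite vE bool_neq0 e7; split.
    by split=> //; split=> //; case: ifP.
  case: I2 => [[m [mk mok [m8 m9 m7] mlt mmax]]|[n8 n7 nle]].
    left; rewrite m7; case: ltrP => mk_wt.
      exists k; split=> //=; first exact: lt_trans mk_wt.
      move=> m'; rewrite ltnS leq_eqVlt => /orP[/eqP->//|m'k m'ok].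
      exact: le_trans (mmax _ m'k m'ok) (ltW mk_wt).
    exists m; split=> //=; [exact: ltnW|by rewrite e8 e9 e7|].
    by move=> m'; rewrite ltnS leq_eqVlt => /orP[/eqP->//|/mmax].
  rewrite n7; case: ltrP => mk_wt; [left|right].
    exists k; split=> //=.
    move=> m'; rewrite ltnS leq_eqVlt => /orP[/eqP->//|m'k m'ok].
    exact: le_trans (nle _ m'k m'ok) (ltW mk_wt).
  split=> /=; rewrite ?e8 ?e7 //.
  by move=> m'; rewrite ltnS leq_eqVlt => /orP[/eqP->//|/nle].
have a1 : agree scratch [::] s (sem c s1).
  apply: (@agree_trans _ _ _ s1); first exact: agree_set_var.
  have := sem_agree c s1; rewrite (mab : marrs c = [::]).
  by apply: agree_sub => // y; exact: bodymem.
rewrite /best_prog -/body -/c; clearbody c; rewrite /= -/s1.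
move: (sem c s1) a1 inv => s2 a2 inv.
have v2 y : y \notin scratch -> vars s2 y = vars s y by exact: a2.1.
have aE b : arrs s2 b = arrs s b by rewrite a2.2.
case: inv => [[m [mk mok [m8 m9 m7] mlt mmax]]|[n8 n7 nle]]; last first.
  rewrite n8 /=; split=> //; last by right.
  by move=> T i J _ _; apply: cell_arrs.
rewrite m8 le0z_nat /=.
have [cA cB disj Xdisj] := Hcell m mk mok.
have [alA alB] := Halias m mk mok.
have k2 : keeps TD dst s s2 by move=> T i J _ _; apply: cell_arrs.
have [||||b3 c3 k3] := @fill_spec TD (V 7) (#0 < Rd TA.+1 (V 8 * V 0 + V 6) +
     Rd TB.+1 (V 9 * V 0 + V 6) + (V 6 == V 14))%P s2 dst (X :|: (SA m :|: SB m)).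
- by rewrite v2.
- by rewrite v2.
- by rewrite /= m7.
- move=> s3 j v3 j3 k3 /=.
  have [_ bA] := k3 _ _ _ TAD alA (k2 _ _ _ TAD alA cA).
  have [_ bB] := k3 _ _ _ TBD alB (k2 _ _ _ TBD alB cB).
  rewrite j3 !v3 // m8 m9 !(v2 0%N) // s0 (v2 14%N) // -s14.
  rewrite -!PoszM -!PoszD bA bB !inE.
  by case: (j \in X); case: (j \in SA m); case: (j \in SB m).
split=> //; first exact: keeps_trans k2 k3.
by left; exists m.
Qed.

Definition getset (s : state) T i : {set 'I_n} :=
  [set j : 'I_n | arrs s T.+1 (i * n + j)%N%:Z != 0].

Lemma cell_getset s T i J : cell s T i J -> getset s T i = J.
Proof.
by move=> [_ b]; apply/setP => j; rewrite inE b bool_neq0.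
Qed.

Lemma divz_bounds (z : int) (m : nat) : (0 < m)%N -> 0 <= z ->
  exists2 q : nat, (z %/ m)%Z = q%:Z & (m * q)%N%:Z <= z < (m * q.+1)%N%:Z.
Proof.
move=> m0 z0; have e := divz_eq z m; have l := ltz_pmod z (d := m) ltac:(lia).
have g := modz_ge0 z (d := m) ltac:(lia).
have q0 : 0 <= (z %/ m)%Z by rewrite divz_ge0; lia.
by exists `|(z %/ m)%Z|%N; nia.
Qed.

Local Notation p := (plen I).
Local Notation r := (release I).
Local Notation d := (deadline I).
Variables rpos dpos : 'I_n -> nat.
Hypothesis rpos_inj : injective rpos.
Hypothesis rpos_surj : forall x, (x < n)%N -> exists j, rpos j = x.
Hypothesis rpos_lt : forall j, (rpos j < n)%N.
Hypothesis rpos_mono : forall i j, (rpos i < rpos j)%N -> r i <= r j.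
Hypothesis dpos_inj : injective dpos.
Hypothesis dpos_surj : forall x, (x < n)%N -> exists j, dpos j = x.
Hypothesis dpos_lt : forall j, (dpos j < n)%N.
Hypothesis dpos_mono : forall i j, (dpos i < dpos j)%N -> d i <= d j.
Hypothesis weight_bound : forall J, (set_weight I J <= Z ^ dv 10)%N.

Record context (s : state) : Prop := Context {
  ctx_n : vars s 0 = n%:Z;
  ctx_p : vars s 1 = p%:Z;
  ctx_r : forall j : 'I_n, arrs s 0 j%:Z = r j;
  ctx_d : forall j : 'I_n, arrs s 1 j%:Z = d j;
  ctx_w : forall j : 'I_n, arrs s 2 j%:Z = (weight I j)%:Z;
  ctx_rpos : forall j : 'I_n, arrs s 4 (rpos j)%:Z = j%:Z;
  ctx_dpos : forall j : 'I_n, arrs s 5 (dpos j)%:Z = j%:Z }.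

Lemma context_agree V A s s' : agree V A s s' ->
  all (fun x => x \notin V) [:: 0; 1]%N ->
  all (fun a => a \notin A) [:: 0; 1; 2; 4; 5]%N -> context s -> context s'.
Proof.
move=> [av aa] /allP vV /allP aA [].
by split; rewrite ?av ?vV // => *; rewrite aa ?aA.
Qed.

(* Array 4 (5) holds the jobs in order of release (deadline).  The job jk of rank
   k = V 17 is being inserted into the row of the x-th start, x = V 18.  Further
   registers: 19 jk, 20 the start a = r_(jx), 21 r_(jk), 29 d_(jk), 30 and 24
   the numbers Q and f of gapped schedules from a to a + Q p + f, 25 a bound on
   the candidates m, 26 and 27 the quotient and the remainder of r_m - a by p.
   Table 6 holds at x * (n + 1) + g the best block of g jobs from the x-th start,
   table 8 the best gapped schedules (at m < n if they end at r_m, and at n + Q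
   if they end at a + (Q + 1) p), table 10 at x the best set from the x-th start
   on.  Candidate m = x stands for no gap in gap_pre, and for no block after the
   completion of jk in take_pre. *)
Definition gap_pre : prog :=
  (26 ::= (Rd 0 (Rd 4 (V 5)) - V 20) %/ V 1;;
   27 ::= Rd 0 (Rd 4 (V 5)) - V 20 - V 26 * V 1;;
   11 ::= V 5;;
   12 ::= V 5 * (V 0 + #1) + (V 30 - V 26);;
   13 ::= (V 18 <= V 5) * (V 5 < V 25) *
     ((V 5 == V 18) + (V 21 <= V 20 + V 26 * V 1)) *
     (V 27 <= V 24) * (V 26 <= V 30))%P.

Definition rows s k x : Prop := forall j g, (g <= n)%N ->
  exists2 J, cell s 6 (rpos j * n.+1 + g) J &
    best_block I dpos (k + (rpos j < x)) (r j) g J.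

(* The row of the start a = r jx, while the job jk is being inserted. *)
Section Row.
Variables jx jk : 'I_n.
Let x := rpos jx.
Let k := dpos jk.
Let a := r jx.
Let rk := r jk.
Let steps (m : 'I_n) : nat := `|((r m - a) %/ p)%Z|%N.

Definition gap_cells s ub : Prop := forall m, (x <= rpos m < ub)%N ->
  m = jx \/ (steps m < n)%N /\ rk <= a + (p * steps m)%N%:Z ->
  exists2 J, cell s 8 (rpos m) J &
    if m == jx then J = set0 else best_gapped I dpos k a (steps m) (r m) rk J.

Lemma stepsP (m : 'I_n) : (x <= rpos m)%N ->
  [/\ a <= r m, ((r m - a) %/ p)%Z = (steps m)%:Z,
     a + (p * steps m)%N%:Z <= r m & r m < a + (p * (steps m).+1)%N%:Z].
Proof.
move=> xm; have am : a <= r m.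
  by move: xm; rewrite leq_eqVlt => /orP[/eqP/rpos_inj <-//|/rpos_mono].
have [q qE qb] := @divz_bounds (r m - a) p (plen_gt0 I) ltac:(lia).
by rewrite /steps qE absz_nat; split=> //; lia.
Qed.

Lemma gap_spec s ub Q f dst :
  context s -> rows s k x -> gap_cells s ub ->
  vars s 18 = x%:Z -> vars s 20 = a -> vars s 21 = rk -> vars s 24 = f ->
  vars s 25 = ub%:Z -> vars s 30 = Q%:Z -> vars s 16 = dst%:Z ->
  vars s 7 = -1 -> vars s 14 = -1 -> vars s 15 = 0 ->
  (x < ub <= dst)%N -> (Q < n)%N -> a <= rk <= a + (p * Q)%N%:Z -> 0 <= f <= p%:Z ->
  (forall m : 'I_n, (x < rpos m)%N -> r m < a + (p * Q)%N%:Z + f -> (rpos m < ub)%N) ->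
  let c := best_prog gap_pre 8 6 8 in
  [/\ bounds_ok c s, keeps 8 dst s (sem c s) &
    exists2 J, cell (sem c s) 8 dst J &
      best_gapped I dpos k a Q (a + (p * Q)%N%:Z + f) rk J].
Proof.
move=> cs rs gs s18 s20 s21 s24 s25 s30 s16 s7 s14 s15 xub Qn rkQ fp ubP c.
have p0 := plen_gt0 I.
pose R (m : nat) : int := arrs s 0 (arrs s 4 m%:Z).
have RE j : R (rpos j) = r j by rewrite /R ctx_rpos // ctx_r.
pose q (m : nat) : int := ((R m - a) %/ p)%Z.
pose ok (m : nat) : bool := [&& (x <= m)%N, (m < ub)%N,
  (m == x) || (rk <= a + q m * p%:Z), R m - a - q m * p%:Z <= f & q m <= Q%:Z].
have okP m : (m < n)%N -> ok m -> exists2 j : 'I_n, rpos j = m &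
    [/\ (x <= rpos j < ub)%N, j = jx \/ rk <= a + (p * steps j)%N%:Z,
      r j - a - (p * steps j)%N%:Z <= f & (steps j <= Q)%N].
  move=> /rpos_surj[j jm] /and5P[o1 o2 o3 o4 o5]; exists j => //.
  have [aj qj _ _] := @stepsP j ltac:(by rewrite jm).
  move: o3 o4 o5; rewrite /q -jm RE qj -PoszM mulnC => o3 o4 o5.
  split=> //; first by rewrite jm o1.
  by case/orP: o3 => [/eqP/rpos_inj|]; [left|right].
have okI j : (x <= rpos j < ub)%N -> j = jx \/ rk <= a + (p * steps j)%N%:Z ->
    r j - a - (p * steps j)%N%:Z <= f -> (steps j <= Q)%N -> ok (rpos j).
  move=> /andP[o1 o2] o3 o4 o5; have [aj qj _ _] := stepsP o1.
  rewrite /ok o1 o2 /q RE qj -PoszM (mulnC _ p) o4 lez_nat o5 !andbT.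
  by case: o3 => [->|->]; rewrite ?eqxx ?orbT.
have aE : r jx = a by [].
have steps0 : steps jx = 0%N by rewrite /steps subrr div0z.
pose ib (m : nat) := (m * n.+1 + (Q - `|q m|))%N.
pose SA m := getset s 8 m; pose SB m := getset s 6 (ib m).
have cells j : ok (rpos j) -> (x <= rpos j < ub)%N ->
    j = jx \/ rk <= a + (p * steps j)%N%:Z -> (steps j <= Q)%N ->
    [/\ cell s 8 (rpos j) (SA (rpos j)), cell s 6 (ib (rpos j)) (SB (rpos j)),
     if j == jx then SA (rpos j) = set0
     else best_gapped I dpos k a (steps j) (r j) rk (SA (rpos j)) &
     best_block I dpos k (r j) (Q - steps j) (SB (rpos j))].
  move=> _ jub j3 jQ; have [aj qj _ _] := @stepsP j ltac:(by case/andP: jub).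
  have jv : j = jx \/ (steps j < n)%N /\ rk <= a + (p * steps j)%N%:Z.
    by case: j3; [left|right; split=> //; lia].
  have [JA cA bA] := gs j jub jv.
  have ibE : ib (rpos j) = (rpos j * n.+1 + (Q - steps j))%N.
    by rewrite /ib /q RE qj absz_nat.
  have [|JB cB bB] := rs j (Q - steps j)%N; first by lia.
  rewrite -ibE in cB; rewrite /SA (cell_getset cA) /SB (cell_getset cB); split=> //.
  by move: bB; rewrite (_ : (rpos j < x)%N = false) ?addn0 //; lia.
have union j : ok (rpos j) -> (x <= rpos j < ub)%N ->
    j = jx \/ rk <= a + (p * steps j)%N%:Z ->
    r j - a - (p * steps j)%N%:Z <= f -> (steps j <= Q)%N ->
    gapped I dpos k a Q (a + (p * Q)%N%:Z + f) rk (SA (rpos j) :|: SB (rpos j)) /\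
    [disjoint SA (rpos j) & SB (rpos j)].
  move=> jok jub j3 j4 j5; have [_ _ bA [bB _]] := cells j jok jub j3 j5.
  have [aj qj jl jr] := @stepsP j ltac:(by case/andP: jub).
  case: eqP bA j3 => [jE -> _|jn [bA _] [/jn//|j3]].
    rewrite set0U disjoint_sym -setI_eq0 setI0 eqxx; split=> //.
    rewrite jE steps0 subn0 in bB; rewrite jE; apply: block_gapped => //; lia.
  have := gapped_setU bA bB aj; rewrite subnKC //; apply.
  have : (p * Q = p * steps j + p * (Q - steps j))%N by rewrite -mulnDr subnKC.
  lia.
have [|||||||||m s' mn ag m5|m mn mok|m mn mok|bc kc res] :=
    @best_spec gap_pre 8 6 8 s dst set0 ok id ib SA SB.
- exact: weight_bound.
- by [].
- by [].
- by [].
- by [].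
- exact: ctx_n.
- by [].
- by rewrite s15 /set_weight big_set0.
- by move=> j; rewrite inE s14.
- have e18 : vars s' 18 = x%:Z by rewrite ag.1.
  have e20 : vars s' 20 = a by rewrite ag.1.
  have e21 : vars s' 21 = rk by rewrite ag.1.
  have e24 : vars s' 24 = f by rewrite ag.1.
  have e25 : vars s' 25 = ub%:Z by rewrite ag.1.
  have e30 : vars s' 30 = Q%:Z by rewrite ag.1.
  have e0 : vars s' 0 = n%:Z by rewrite ag.1 // ctx_n.
  have e1 : vars s' 1 = p%:Z by rewrite ag.1 // ctx_p.
  have RmE : arrs s' 0 (arrs s' 4 m%:Z) = R m by rewrite !ag.2.
  rewrite /= e18 e20 e21 e24 e25 e30 e0 e1 m5 RmE -/(q m).
  split=> //; first by rewrite !(mulf_eq0, negb_or, bool_neq0, boolD_neq0) !lez_nat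
    !ltz_nat !eqz_nat -!andbA.
  case/and5P=> mx _ _ _ mQ; split=> //.
  have [j jm] := rpos_surj mn; rewrite -jm in mx *.
  have [_ qj _ _] := stepsP mx; move: mQ; rewrite /ib /q -jm RE qj lez_nat absz_nat => mQ.
  by rewrite -addn1; lia.
- have [j jm [jub j3 j4 j5]] := okP m mn mok; rewrite -jm in mok *.
  have [cA cB _ _] := cells j mok jub j3 j5.
  have [_ dAB] := union j mok jub j3 j4 j5; split=> //.
  by rewrite -setI_eq0 set0I.
- by case/and5P: mok => _ mub _ _ _; split=> // _; lia.
split=> //.
have jxok : ok (rpos jx).
  apply: okI; rewrite ?steps0 ?muln0; [by rewrite leqnn; case/andP: xub|by left|lia|by []].
case: res => [[m [mn mok cm _ mmax]]|[/(_ _ (rpos_lt _) jxok)]]; last by rewrite s7.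
have [j jm [jub j3 j4 j5]] := okP m mn mok; rewrite -jm in mok mmax cm.
rewrite set0U in cm; eexists; first exact: cm.
have [gAB dAB] := union j mok jub j3 j4 j5.
split=> // J' gJ' stJ'.
have {}mmax i : ok (rpos i) -> (x <= rpos i < ub)%N ->
    i = jx \/ rk <= a + (p * steps i)%N%:Z ->
    r i - a - (p * steps i)%N%:Z <= f -> (steps i <= Q)%N ->
    (set_weight I (SA (rpos i)) + set_weight I (SB (rpos i)) <=
     set_weight I (SA (rpos j) :|: SB (rpos j)))%N.
  move=> iok iub i3 i4 i5; have := mmax _ (rpos_lt i) iok.
  have [_ dI] := union i iok iub i3 i4 i5.
  by rewrite !set0U (set_weightU _ dI).
have [||bJ|] := gapped_split gJ' stJ'.
- by case/andP: rkQ.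
- rewrite mulnS; lia.
- have jub0 : (x <= rpos jx < ub)%N by rewrite leqnn; case/andP: xub.
  have j40 : r jx - a - (p * steps jx)%N%:Z <= f by rewrite steps0; lia.
  have [_ _ _ [_ bB]] := cells jx jxok jub0 (or_introl erefl) ltac:(by rewrite steps0).
  have := mmax jx jxok jub0 (or_introl erefl) j40 ltac:(by rewrite steps0).
  have := bB J'; rewrite steps0 subn0 => /(_ bJ stJ'.1); lia.
move=> [i [Q1 [e [A1 [B1 [[iJ Qe e0 [ir ie -> dis]] [gA1 stA1 rkQ1 bB1 cB1]]]]]]].
have xi : (x <= rpos i)%N.
  rewrite leqNgt; apply/negP => /rpos_mono; lia.
have [ai qi il iru] := stepsP xi.
have stQ : steps i = Q1 by nia.
have iub : (rpos i < ub)%N.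
  move: xi; rewrite leq_eqVlt => /orP[/eqP/rpos_inj ji|xi].
    by move: ir; rewrite -ji; lia.
  apply: ubP => //; have : (p * Q = p * Q1 + p * e)%N by rewrite -mulnDr Qe.
  lia.
have ijx : i <> jx by move=> ij; move: ir; rewrite ij; lia.
have iv : i = jx \/ rk <= a + (p * steps i)%N%:Z by right; rewrite stQ.
have iub2 : (x <= rpos i < ub)%N by rewrite xi.
have i4 : r i - a - (p * steps i)%N%:Z <= f.
  have : (p * Q = p * Q1 + p * e)%N by rewrite -mulnDr Qe.
  rewrite stQ; lia.
have i5 : (steps i <= Q)%N by lia.
have iok := okI i iub2 iv i4 i5.
have [_ _ bA [_ bB]] := cells i iok iub2 iv i5.
have := mmax i iok iub2 iv i4 i5; rewrite (set_weightU _ dis).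
case: eqP bA => // _ [_ /(_ A1)]; rewrite stQ => /(_ gA1 stA1).
have QQ : (Q - steps i = e)%N by lia.
have := bB B1; rewrite QQ => /(_ bB1 cB1); lia.
Qed.

Definition paused_cells s : Prop := forall Q, (Q < n)%N ->
  rk <= a + (p * Q)%N%:Z ->
  exists2 J, cell s 8 (n + Q) J &
    best_gapped I dpos k a Q (a + (p * Q.+1)%N%:Z) rk J.

Definition rows_upto s g : Prop := forall j h, (h <= n)%N ->
  exists2 J, cell s 6 (rpos j * n.+1 + h) J &
    best_block I dpos (k + ((rpos j < x)%N || (j == jx) && (h < g)%N)) (r j) h J.

Definition take_pre : prog :=
  (26 ::= (Rd 0 (Rd 4 (V 5)) - V 20) %/ V 1;;
   27 ::= Rd 0 (Rd 4 (V 5)) - V 20 - V 26 * V 1;;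
   23 ::= V 26 + (V 5 == V 18) * V 28;;
   11 ::= V 0 + (V 23 - #1);;
   12 ::= V 5 * (V 0 + #1) + (V 28 - V 23);;
   13 ::= (V 18 <= V 5) * (V 27 == #0) * (#1 <= V 23) * (V 23 <= V 28) *
     (V 21 <= V 20 + (V 23 - #1) * V 1) * (V 20 + V 23 * V 1 <= V 29))%P.

Lemma block0 l b J : block I dpos l b 0 J -> J = set0.
Proof.
move=> [_ _ sJ fJ]; have := card_fits sJ fJ; rewrite leqn0 cards_eq0.
by move=> /eqP.
Qed.

Lemma block_set0 l b g : block I dpos l b g set0.
Proof.
split=> [u v|j|j|u]; rewrite ?inE //.
  by rewrite /demand (_ : [set _ in _ | _] = set0) ?cards0 //; apply/setP => j; rewrite !inE.
by rewrite /late (_ : [set _ in _ | _] = set0) ?cards0 //; apply/setP => j; rewrite !inE.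
Qed.

Lemma best_block0 l l' b J : best_block I dpos l b 0 J -> best_block I dpos l' b 0 J.
Proof.
move=> [/block0-> _]; split; first exact: block_set0.
by move=> J' _ /eqP; rewrite cards_eq0 => /eqP->.
Qed.

Lemma take_spec s g :
  context s -> rows_upto s g -> paused_cells s ->
  vars s 18 = x%:Z -> vars s 20 = a -> vars s 21 = rk -> vars s 28 = g%:Z ->
  vars s 29 = d jk -> vars s 16 = (x * n.+1 + g)%N%:Z ->
  vars s 14 = jk%:Z -> vars s 15 = (weight I jk)%:Z ->
  vars s 7 = arrs s 6 (x * n.+1 + g)%N%:Z ->
  (0 < g <= n)%N -> a <= rk ->
  let c := best_prog take_pre 8 6 6 in
  [/\ bounds_ok c s, keeps 6 (x * n.+1 + g) s (sem c s) &
    exists2 J, cell (sem c s) 6 (x * n.+1 + g) J & best_block I dpos k.+1 a g J].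
Proof.
move=> cs rs ps s18 s20 s21 s28 s29 s16 s14 s15 s7 g0n ark; set dst := (_ + g)%N => pg.
have /andP[g0 gn] := g0n.
have p0 := plen_gt0 I.
pose R (m : nat) : int := arrs s 0 (arrs s 4 m%:Z).
have RE j : R (rpos j) = r j by rewrite /R ctx_rpos // ctx_r.
pose q (m : nat) : int := ((R m - a) %/ p)%Z.
pose c (m : nat) : int := q m + (m == x)%:Z * g%:Z.
pose ok (m : nat) : bool := [&& (x <= m)%N, R m - a - q m * p%:Z == 0,
  1 <= c m, c m <= g%:Z, rk <= a + (c m - 1) * p%:Z & a + c m * p%:Z <= d jk].
have aE : r jx = a by [].
have steps0 : steps jx = 0%N by rewrite /steps subrr div0z.
pose place j Q := j = jx /\ Q.+1 = g \/ (x < rpos j)%N /\ r j = a + (p * Q.+1)%N%:Z.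
have okP m : (m < n)%N -> ok m -> exists j Q, [/\ rpos j = m, c m = Q.+1%:Z, place j Q &
    [/\ (Q < g)%N, rk <= a + (p * Q)%N%:Z & a + (p * Q.+1)%N%:Z <= d jk]].
  move=> /rpos_surj[j jm] /and5P[o1 o2 o3 o4 /andP[o5 o6]].
  have [aj qj jl jr] := @stepsP j ltac:(by rewrite jm).
  exists j, `|c m - 1|%N.
  have cE : c m = `|c m - 1|%N.+1%:Z by lia.
  move: o2 o4 o5 o6; rewrite cE; move: (`|c m - 1|%N) cE => Q cE.
  rewrite (_ : Q.+1%:Z - 1 = Q%:Z); last by lia.
  rewrite -!PoszM (mulnC _ p) (mulnC _ p) => o2 o4 o5 o6; split=> //.
  move: cE o2; rewrite /c /q -jm RE qj /place.
  case: eqP => [/rpos_inj ->|jx']; first by rewrite steps0; left; split=> //; lia.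
  rewrite mul0r addr0 => -[->] /eqP; rewrite -PoszM (mulnC _ p) => H; right.
  split; last by lia.
  by move: o1; rewrite -jm leq_eqVlt eq_sym => /orP[/eqP//|].
have okI j Q : place j Q -> (Q < g)%N -> rk <= a + (p * Q)%N%:Z ->
    a + (p * Q.+1)%N%:Z <= d jk -> ok (rpos j) /\ c (rpos j) = Q.+1%:Z.
  move=> pjQ Qg rkQ dQ; have xj : (x <= rpos j)%N.
    by case: pjQ => [[-> _]|[/ltnW]].
  have [aj qj jl jr] := stepsP xj.
  suff [cE fE] : c (rpos j) = Q.+1%:Z /\ r j - a - (p * steps j)%N%:Z = 0.
    split=> //; rewrite /ok xj cE /q RE qj (_ : Q.+1%:Z - 1 = Q%:Z); last by lia.
    by rewrite -!PoszM !(mulnC _ p) fE rkQ dQ eqxx /= !andbT lez_nat.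
  rewrite /c /q RE qj; case: pjQ => [[-> <-]|[xj' rj]].
    by rewrite eqxx steps0 muln0 aE; lia.
  have -> : steps j = Q.+1 by nia.
  by rewrite (_ : (rpos j == x) = false) ?rj; [lia|apply/negbTE; lia].
pose ia (m : nat) := (n + `|c m - 1|)%N.
pose ib (m : nat) := (m * n.+1 + `|g%:Z - c m|)%N.
pose SA m := getset s 8 (ia m); pose SB m := getset s 6 (ib m).
have cells j Q : c (rpos j) = Q.+1%:Z -> place j Q -> (Q < g)%N ->
    rk <= a + (p * Q)%N%:Z ->
    [/\ cell s 8 (ia (rpos j)) (SA (rpos j)), cell s 6 (ib (rpos j)) (SB (rpos j)),
     best_gapped I dpos k a Q (a + (p * Q.+1)%N%:Z) rk (SA (rpos j)) &
     if j == jx then SB (rpos j) = set0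
     else best_block I dpos k (r j) (g - Q.+1) (SB (rpos j))].
  move=> cE pjQ Qg rkQ; have [|JA cA bA] := ps Q _ rkQ; first by lia.
  have iaE : ia (rpos j) = (n + Q)%N by rewrite /ia cE; lia.
  have ibE : ib (rpos j) = (rpos j * n.+1 + (g - Q.+1))%N.
    by rewrite /ib cE; congr (_ + _)%N; lia.
  have [|JB cB bB] := rs j (g - Q.+1)%N; first by lia.
  rewrite -ibE in cB; rewrite -iaE in cA.
  rewrite /SA (cell_getset cA) /SB (cell_getset cB); split=> //.
  case: pjQ bB => [[-> <-]|[xj rj]] bB.
    by rewrite eqxx; rewrite subnn in bB; exact: block0 bB.1.
  have jjx : (j == jx) = false by apply/eqP => jE; move: xj; rewrite jE ltnn.
  by rewrite jjx; move: bB; rewrite jjx (_ : (rpos j < x)%N = false) ?addn0 //; lia.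
have union j Q : c (rpos j) = Q.+1%:Z -> place j Q -> (Q < g)%N ->
    rk <= a + (p * Q)%N%:Z -> a + (p * Q.+1)%N%:Z <= d jk ->
    [/\ block I dpos k.+1 a g ([set jk] :|: (SA (rpos j) :|: SB (rpos j))),
      [disjoint SA (rpos j) & SB (rpos j)] &
      [disjoint [set jk] & SA (rpos j) :|: SB (rpos j)]].
  move=> cE pjQ Qg rkQ dQ; have [_ _ [gA _] bB] := cells j Q cE pjQ Qg rkQ.
  have [blA jA] := gapped_add gA ark dQ.
  have {bB} [bl dis jB] : [/\ block I dpos k.+1 a g ((jk |: SA (rpos j)) :|: SB (rpos j)),
      [disjoint jk |: SA (rpos j) & SB (rpos j)] & jk \notin SB (rpos j)].
    case: eqP bB => [jE ->|jjx [bB _]].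
      rewrite setU0 inE; split=> //; last by rewrite -setI_eq0 setI0.
      by case: pjQ => [[_ <-]|[xj _]] //; move: xj; rewrite jE ltnn.
    have rj : r j = a + (p * Q.+1)%N%:Z by case: pjQ => [[]|[]].
    have gQ : (p * g = p * Q.+1 + p * (g - Q.+1))%N by rewrite -mulnDr subnKC.
    have [bl dis] := block_setU (g := g) blA bB (leqnSn _) ltac:(lia) ltac:(lia).
    split=> //; case: bB => _ kB _ _; apply/negP => /kB; by rewrite ltnn.
  split; first by rewrite setUA.
    by apply: disjointWl dis; apply: subsetUr.
  by rewrite disjoints1 inE negb_or jA.
have [J0 c0 b0] := rs jx g gn.
move: b0; rewrite eqxx ltnn ltnn addn0 -/a => b0.
have w0 : vars s 7 = (set_weight I J0)%:Z by rewrite s7; case: c0.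
have wt_le j Q J' : c (rpos j) = Q.+1%:Z -> place j Q -> (Q < g)%N ->
    rk <= a + (p * Q)%N%:Z -> a + (p * Q.+1)%N%:Z <= d jk ->
    forall A B, J' = jk |: (A :|: B) -> jk \notin A :|: B -> [disjoint A & B] ->
    gapped I dpos k a Q (a + (p * Q.+1)%N%:Z) rk A -> steady I a Q A ->
    (B = set0 \/ j <> jx /\ block I dpos k (r j) (g - Q.+1) B /\ #|B| = (g - Q.+1)%N) ->
    (set_weight I J' <= set_weight I ([set jk] :|: (SA (rpos j) :|: SB (rpos j))))%N.
  move=> cE pjQ Qg rkQ dQ A B -> jAB AB gA stA hB.
  have [_ _ [_ bA] bB] := cells j Q cE pjQ Qg rkQ.
  have [_ dS jS] := union j Q cE pjQ Qg rkQ dQ.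
  have jAB' : [disjoint [set jk] & A :|: B] by rewrite disjoints1.
  rewrite !(set_weightU _ jS) (set_weightU _ jAB') (set_weightU _ dS) (set_weightU _ AB).
  rewrite leq_add2l; apply: leq_add; first exact: bA.
  case: hB => [->|[jjx [blB cB]]]; first by rewrite /set_weight big_set0.
  by case: eqP bB => // _ [_ /(_ B)]; apply.
have best J' : block I dpos k.+1 a g J' -> #|J'| = g ->
    (set_weight I J' <= set_weight I J0)%N \/ exists m, [/\ (m < n)%N, ok m &
      (set_weight I J' <= set_weight I ([set jk] :|: (SA m :|: SB m)))%N].
  move=> blJ' cJ'.
  have [bl|] := block_split dpos_mono (fun l => @dpos_inj l jk) blJ' cJ'.
    by left; exact: b0.2.
  move=> [Q [A [B [[Qg J'E jAB dAB] [gA stA /andP[_ rkQ] dQ hB]]]]]; right.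
  have [j [pjQ hB']] : exists j, place j Q /\
      (B = set0 \/ j <> jx /\ block I dpos k (r j) (g - Q.+1) B /\ #|B| = (g - Q.+1)%N).
    case: hB => [[B0 Qg']|[m mB [rm blB cB]]].
      by exists jx; split; left.
    have xm : (x < rpos m)%N.
      rewrite ltnNge leq_eqVlt; apply/negP => /orP[/eqP/rpos_inj mE|/rpos_mono].
        by move: rm; rewrite mE mulnS -/a; lia.
      by rewrite rm mulnS -/a; lia.
    exists m; split; first by right.
    by right; split=> // mE; move: xm; rewrite mE ltnn.
  have [jok cE] := okI j Q pjQ Qg rkQ dQ.
  by exists (rpos j); split=> //; exact: wt_le gA stA hB'.
have weak : block I dpos k.+1 a g J0.
  case: b0 => [[hJ kJ sJ fJ] _]; split=> // j /kJ; exact: leqW.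
have [|||||||||m s' mn ag m5|m mn mok|m mn mok|bc kc res] :=
    @best_spec take_pre 8 6 6 s dst [set jk] ok ia ib SA SB.
- exact: weight_bound.
- by [].
- by [].
- by [].
- by [].
- exact: ctx_n.
- by [].
- by rewrite s15 /set_weight big_set1.
- by move=> j; rewrite inE s14 eqz_nat.
- have e18 : vars s' 18 = x%:Z by rewrite ag.1.
  have e20 : vars s' 20 = a by rewrite ag.1.
  have e21 : vars s' 21 = rk by rewrite ag.1.
  have e28 : vars s' 28 = g%:Z by rewrite ag.1.
  have e29 : vars s' 29 = d jk by rewrite ag.1.
  have e0 : vars s' 0 = n%:Z by rewrite ag.1 // ctx_n.
  have e1 : vars s' 1 = p%:Z by rewrite ag.1 // ctx_p.
  have RmE : arrs s' 0 (arrs s' 4 m%:Z) = R m by rewrite !ag.2.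
  rewrite /= e18 e20 e21 e28 e29 e0 e1 m5 RmE -/(q m) eqz_nat -/(c m).
  split=> //; first by rewrite !(mulf_eq0, negb_or, bool_neq0) !lez_nat -!andbA.
  move=> mok; have [j [Q [jm cE _ [Qg _ _]]]] := okP m mn mok.
  by rewrite /ia /ib cE -addn1; split; lia.
- have [j [Q [jm cE pjQ [Qg rkQ dQ]]]] := okP m mn mok; rewrite -jm in cE *.
  have [cA cB _ _] := cells j Q cE pjQ Qg rkQ.
  by have [_ dS jS] := union j Q cE pjQ Qg rkQ dQ.
- have [j [Q [jm cE pjQ [Qg rkQ dQ]]]] := okP m mn mok; split=> // _.
  rewrite /ib cE -jm /dst; case: pjQ => [[-> <-]|[xj _]]; first by rewrite -/x; lia.
  have : (x * n.+1 + n.+1 <= rpos j * n.+1)%N by rewrite addnC -mulSn leq_mul2r xj orbT.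
  lia.
split=> //; case: res => [[m [mn mok cm mlt mmax]]|[mle sE]].
  have [j [Q [jm cE pjQ [Qg rkQ dQ]]]] := okP m mn mok; rewrite -jm in cE.
  have [bl _ _] := union j Q cE pjQ Qg rkQ dQ; rewrite jm in bl.
  eexists; first exact: cm.
  split=> // J' blJ' cJ'; case: (best J' blJ' cJ') => [|[m' [m'n m'ok le]]].
    by move: mlt; rewrite w0 ltz_nat => lt le; exact: leq_trans le (ltnW lt).
  by have := mmax m' m'n m'ok; rewrite lez_nat; exact: leq_trans.
exists J0; first by apply: cell_arrs c0; apply: sE.
split=> // J' blJ' cJ'; case: (best J' blJ' cJ') => [//|[m' [m'n m'ok le]]].
by have := mle m' m'n m'ok; rewrite w0 lez_nat; exact: leq_trans.
Qed.

Arguments best_prog : simpl never.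

Definition gap_setup : prog :=
  (30 ::= (Rd 0 (Rd 4 (V 22)) - V 20) %/ V 1;;
   24 ::= Rd 0 (Rd 4 (V 22)) - V 20 - V 30 * V 1;;
   25 ::= V 22;;
   16 ::= V 22;;
   7 ::= #(-1))%P.

Definition gap_body : prog :=
  (gap_setup;;
   PIf ((V 18 < V 22) * (V 30 < V 0) * (V 21 <= V 20 + V 30 * V 1))
     (best_prog gap_pre 8 6 8) PSkip)%P.

Definition pause_setup : prog :=
  (30 ::= V 22;;
   24 ::= V 1;;
   25 ::= V 0;;
   16 ::= V 0 + V 22;;
   7 ::= #(-1))%P.

Definition pause_body : prog :=
  (pause_setup;;
   PIf (V 21 <= V 20 + V 30 * V 1) (best_prog gap_pre 8 6 8) PSkip)%P.

Definition take_setup : prog :=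
  (14 ::= V 19;;
   15 ::= Rd 2 (V 19);;
   28 ::= V 22 + #1;;
   16 ::= V 18 * (V 0 + #1) + V 28;;
   7 ::= Rd 6 (V 16))%P.

Definition take_body : prog :=
  (take_setup;;
   best_prog take_pre 8 6 6)%P.

Record row_vars (s : state) : Prop := RowVars {
  rv_ctx : context s;
  rv_x : vars s 18 = x%:Z;
  rv_jk : vars s 19 = jk%:Z;
  rv_a : vars s 20 = a;
  rv_rk : vars s 21 = rk;
  rv_dk : vars s 29 = d jk }.

Lemma row_vars_agree V A s s' : agree V A s s' ->
  all (fun x => x \notin V) [:: 0; 1; 18; 19; 20; 21; 29]%N ->
  all (fun a => a \notin A) [:: 0; 1; 2; 4; 5]%N -> row_vars s -> row_vars s'.
Proof.
move=> ag vV aA [c *]; have av := ag.1; split; rewrite ?av ?(allP vV) //.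
apply: context_agree ag _ aA c; apply/allP => y yin; apply: (allP vV).
by move: yin; rewrite !inE => /orP[]/eqP->.
Qed.

Lemma rows_keeps s s' h dst : keeps 8 dst s s' -> rows s k h -> rows s' k h.
Proof.
by move=> kp rs j g gn; have [J c b] := rs j g gn; exists J => //; apply: kp.
Qed.

Lemma gap_cells_keeps s s' ub dst : keeps 8 dst s s' -> (ub <= dst)%N ->
  gap_cells s ub -> gap_cells s' ub.
Proof.
move=> kp ud gs m mub mv; have [J c b] := gs m mub mv; exists J => //.
by apply: kp => // _; lia.
Qed.

Lemma gaps_spec s : row_vars s -> rows s k x -> cell s 8 x set0 ->
  vars s 14 = -1 -> vars s 15 = 0 -> a <= rk ->
  let c := PFor 22 gap_body in
  [/\ bounds_ok c s, rows (sem c s) k x & gap_cells (sem c s) n].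
Proof.
move=> rv rs cx s14 s15 ark c.
suff [bc [rs' _ gs]] : bounds_ok c s /\ [/\ rows (sem c s) k x,
    cell (sem c s) 8 x set0 & gap_cells (sem c s) n] by [].
apply: (sem_for (Inv := fun i s' =>
  [/\ rows s' k x, cell s' 8 x set0 & gap_cells s' i])); [by []|by []|by []|..].
- by rewrite ctx_n //; case: rv.
- by split=> // m; rewrite ltn0 andbF.
move=> i s1 iN ag i22 [rs1 cx1 gs1].
have rv1 : row_vars s1 by apply: row_vars_agree ag _ _ rv.
have [cx' x1 _ a1 rk1 _] := rv1.
have [j ji] := rpos_surj iN.
have rjE : arrs s1 0 (arrs s1 4 i%:Z) = r j by rewrite -ji ctx_rpos ?ctx_r.
have n1 := ctx_n cx'; have p1 := ctx_p cx'; have p0 := plen_gt0 I.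
pose t := ((r j - a) %/ p)%Z; pose f := r j - a - t * p%:Z.
rewrite /gap_body sem_seq bounds_seq.
have ag2 := sem_agree gap_setup s1.
have e30 : vars (sem gap_setup s1) 30 = t by rewrite /= i22 rjE a1 p1.
have e24 : vars (sem gap_setup s1) 24 = f by rewrite /= i22 rjE a1 p1.
have e25 : vars (sem gap_setup s1) 25 = i%:Z by rewrite /= i22.
have e16 : vars (sem gap_setup s1) 16 = i%:Z by rewrite /= i22.
have e7 : vars (sem gap_setup s1) 7 = -1 by [].
have e22 : vars (sem gap_setup s1) 22 = i%:Z by rewrite /= i22.
have bs : bounds_ok gap_setup s1 by [].
move: (sem gap_setup s1) ag2 e30 e24 e25 e16 e7 e22 => s2 ag2 e30 e24 e25 e16 e7 e22.
have rv2 : row_vars s2 by apply: row_vars_agree ag2 _ _ rv1.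
have [cx2 x2 _ a2 rk2 _] := rv2; have n2 := ctx_n cx2; have p2 := ctx_p cx2.
have s21 y : arrs s2 y = arrs s1 y by apply: ag2.2.
have {}cx1 : cell s2 8 x set0 by apply: cell_arrs cx1.
have {}rs1 : rows s2 k x.
  by move=> h g gn; have [J ? ?] := rs1 h g gn;
    exists J => //; apply: cell_arrs (s21 _) (s21 _) _.
have {}gs1 : gap_cells s2 i.
  by move=> h hi hv; have [J ? ?] := gs1 h hi hv;
    exists J => //; apply: cell_arrs (s21 _) (s21 _) _.
rewrite sem_if bounds_if; set e := (_ * _ * _)%P.
have -> : (eval s2 e != 0) = [&& (x < i)%N, t < n%:Z & rk <= a + t * p%:Z].
  rewrite /= e22 x2 e30 n2 rk2 a2 p2.
  by rewrite !(mulf_eq0, negb_or, bool_neq0) ltz_nat -andbA.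
case: ifP => [/and3P[xi tn rkt]|cond].
  have xj : (x <= rpos j)%N by rewrite ji ltnW.
  have [aj qj jl jr] := stepsP xj.
  have tE : t = (steps j)%:Z by [].
  have [||||||||||||||||||b2 k2 [J cJ bJ]] := @gap_spec s2 i (steps j) f i => //.
  - by rewrite e30 tE.
  - by rewrite ag2.1 // ag.1.
  - by rewrite ag2.1 // ag.1.
  - by rewrite xi leqnn.
  - by move: tn; rewrite tE ltz_nat.
  - by move: rkt; rewrite ark tE -PoszM mulnC.
  - by rewrite /f tE -PoszM mulnC; lia.
  - move=> m xm rm; rewrite -ji ltnNge; apply/negP; rewrite leq_eqVlt.
    case/orP => [/eqP/rpos_inj jm|/rpos_mono]; move: rm; rewrite /f tE -PoszM mulnC -?jm; lia.
  split; first by [].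
  split; [exact: rows_keeps k2 rs1| |].
    by apply: k2 cx1 => // _; lia.
  move=> m /andP[xm]; rewrite ltnS leq_eqVlt => /orP[/eqP mi _|mi mv].
    have mj : m = j by apply: rpos_inj; rewrite mi.
    exists J; first by rewrite mi.
    rewrite mj; case: eqP => [jE|_]; first by move: xi; rewrite -ji jE ltnn.
    suff <- : a + (p * steps j)%N%:Z + f = r j by [].
    by rewrite /f tE -PoszM mulnC; lia.
  by apply: (gap_cells_keeps k2 (leqnn _) gs1) mv; rewrite xm.
split=> //; split=> // m /andP[xm]; rewrite ltnS leq_eqVlt => /orP[/eqP mi mv|mi mv].
  have mj : m = j by apply: rpos_inj; rewrite mi.
  have [mjx|mjx] := eqVneq m jx; first by exists set0 => //; rewrite mjx.
  exfalso; case: mv => [/eqP|[tn rkt]]; first by rewrite (negbTE mjx).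
  move: cond; have -> : (x < i)%N.
    rewrite -mi ltn_neqAle xm andbT; apply: contra mjx => /eqP/rpos_inj <-.
    by rewrite eqxx.
  have [aj qj jl jr] := stepsP xm; rewrite mj in qj tn rkt.
  by rewrite /t qj ltz_nat tn -PoszM mulnC rkt.
by apply: gs1 mv; rewrite xm.
Qed.

Lemma cells_arrs s s' l : (forall y, arrs s' y = arrs s y) ->
  (rows s k l -> rows s' k l) /\ (forall ub, gap_cells s ub -> gap_cells s' ub).
Proof.
move=> sE; split=> [rs j g gn|ub gs m mu mv].
  by have [J ? ?] := rs j g gn;
    exists J => //; apply: cell_arrs (sE _) (sE _) _.
by have [J ? ?] := gs m mu mv;
    exists J => //; apply: cell_arrs (sE _) (sE _) _.
Qed.

Lemma pauses_spec s : row_vars s -> rows s k x -> gap_cells s n ->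
  vars s 14 = -1 -> vars s 15 = 0 -> a <= rk ->
  let c := PFor 22 pause_body in
  [/\ bounds_ok c s, rows (sem c s) k x & paused_cells (sem c s)].
Proof.
move=> rv rs gs s14 s15 ark c.
pose paused i (s' : state) := forall Q, (Q < i)%N -> rk <= a + (p * Q)%N%:Z ->
  exists2 J, cell s' 8 (n + Q) J &
    best_gapped I dpos k a Q (a + (p * Q.+1)%N%:Z) rk J.
suff [bc [rs' _ gs']] : bounds_ok c s /\ [/\ rows (sem c s) k x,
    gap_cells (sem c s) n & paused n (sem c s)] by [].
apply: (sem_for (Inv := fun i s' =>
  [/\ rows s' k x, gap_cells s' n & paused i s'])); [by []|by []|by []|..].
- by rewrite ctx_n //; case: rv.
- by split.
move=> i s1 iN ag i22 [rs1 gs1 ps1].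
have rv1 : row_vars s1 by apply: row_vars_agree ag _ _ rv.
have [cx1 x1 _ a1 rk1 _] := rv1; have n1 := ctx_n cx1; have p1 := ctx_p cx1.
rewrite /pause_body sem_seq bounds_seq.
have ag2 := sem_agree pause_setup s1.
have e30 : vars (sem pause_setup s1) 30 = i%:Z by rewrite /= i22.
have e24 : vars (sem pause_setup s1) 24 = p%:Z by rewrite /= p1.
have e25 : vars (sem pause_setup s1) 25 = n%:Z by rewrite /= n1.
have e16 : vars (sem pause_setup s1) 16 = (n + i)%N%:Z by rewrite /= n1 i22.
have e7 : vars (sem pause_setup s1) 7 = -1 by [].
have bs : bounds_ok pause_setup s1 by [].
move: (sem pause_setup s1) ag2 e30 e24 e25 e16 e7 bs => s2 ag2 e30 e24 e25 e16 e7 bs.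
have rv2 : row_vars s2 by apply: row_vars_agree ag2 _ _ rv1.
have [cx2 x2 _ a2 rk2 _] := rv2; have n2 := ctx_n cx2; have p2 := ctx_p cx2.
have s21 y : arrs s2 y = arrs s1 y by apply: ag2.2.
have {}rs1 : rows s2 k x by apply: (cells_arrs _ s21).1 rs1.
have {}gs1 : gap_cells s2 n by apply: (cells_arrs x s21).2 gs1.
have {}ps1 : paused i s2.
  by move=> Q Qi rkQ; have [J ? ?] := ps1 Q Qi rkQ;
    exists J => //; apply: cell_arrs (s21 _) (s21 _) _.
rewrite sem_if bounds_if; set e := (_ <= _)%P.
have -> : (eval s2 e != 0) = (rk <= a + (p * i)%N%:Z).
  by rewrite /= rk2 a2 e30 p2 bool_neq0 -PoszM mulnC.
case: ifP => rki; last first.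
  split=> //; split=> // Q; rewrite ltnS leq_eqVlt => /orP[/eqP->|]; last exact: ps1.
  by rewrite rki.
have [||||||||||||||||||b2 k2 [J cJ bJ]] := @gap_spec s2 n i p (n + i) => //.
- by rewrite ag2.1 // ag.1.
- by rewrite ag2.1 // ag.1.
- by rewrite rpos_lt leq_addr.
- by rewrite ark.
- by rewrite lexx.
split; first by [].
split; [exact: rows_keeps k2 rs1|exact: gap_cells_keeps k2 (leq_addr _ _) gs1|].
move=> Q; rewrite ltnS leq_eqVlt => /orP[/eqP-> _|Qi rkQ].
  exists J => //; suff -> : a + (p * i.+1)%N%:Z = a + (p * i)%N%:Z + p by [].
  by rewrite mulnS; lia.
have [L cL bL] := ps1 Q Qi rkQ; exists L => //.
by apply: k2 cL => // _; lia.
Qed.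

Lemma takes_spec s : row_vars s -> rows s k x -> paused_cells s -> a <= rk ->
  let c := PFor 22 take_body in
  bounds_ok c s /\ rows (sem c s) k x.+1.
Proof.
move=> rv rs ps ark c.
suff [bc [rs' _]] : bounds_ok c s /\ (rows_upto (sem c s) n.+1 /\
    paused_cells (sem c s)).
  split=> // j g gn; have [J cJ bJ] := rs' j g gn; exists J => //.
  by move: bJ; rewrite !ltnS gn andbT [(rpos j <= x)%N]leq_eqVlt (inj_eq rpos_inj) orbC.
apply: (sem_for (Inv := fun i s' => rows_upto s' i.+1 /\ paused_cells s')); [by []|by []|by []|..].
- by rewrite ctx_n //; case: rv.
- split=> // j g gn; have [J cJ bJ] := rs j g gn; exists J => //.
  case: (g) bJ => [bJ|g' bJ]; first exact: best_block0 bJ.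
  by rewrite ltnS ltn0 andbF orbF.
move=> i s1 iN ag i22 [rs1 ps1].
have rv1 : row_vars s1 by apply: row_vars_agree ag _ _ rv.
have [cx1 x1 jk1 a1 rk1 d1] := rv1; have n1 := ctx_n cx1; have p1 := ctx_p cx1.
rewrite /take_body sem_seq bounds_seq.
have ag2 := sem_agree take_setup s1.
pose dst := (x * n.+1 + i.+1)%N.
have e14 : vars (sem take_setup s1) 14 = jk%:Z by rewrite /= jk1.
have e15 : vars (sem take_setup s1) 15 = (weight I jk)%:Z by rewrite /= jk1 ctx_w.
have e28 : vars (sem take_setup s1) 28 = i.+1%:Z by rewrite /= i22; lia.
have e16 : vars (sem take_setup s1) 16 = dst%:Z.
  by rewrite /= x1 n1 i22 /dst PoszD PoszM -(addn1 n) -(addn1 i) !PoszD.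
have e7 : vars (sem take_setup s1) 7 = arrs s1 6 dst%:Z.
  rewrite -e16; by [].
have bs : bounds_ok take_setup s1 by [].
move: (sem take_setup s1) ag2 e14 e15 e28 e16 e7 bs => s2 ag2 e14 e15 e28 e16 e7 bs.
have rv2 : row_vars s2 by apply: row_vars_agree ag2 _ _ rv1.
have [cx2 x2 _ a2 rk2 d2] := rv2.
have s21 y : arrs s2 y = arrs s1 y by apply: ag2.2.
have {}rs1 : rows_upto s2 i.+1.
  by move=> h g gn; have [J ? ?] := rs1 h g gn;
    exists J => //; apply: cell_arrs (s21 _) (s21 _) _.
have {}ps1 : paused_cells s2.
  by move=> Q Qi rkQ; have [J ? ?] := ps1 Q Qi rkQ;
    exists J => //; apply: cell_arrs (s21 _) (s21 _) _.
have [|b2 k2 [J cJ bJ]] := take_spec cx2 rs1 ps1 x2 a2 rk2 e28 d2 e16 e14 e15 _ iN ark.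
  by rewrite s21.
split; first by [].
split; last first.
  move=> Q Qn rkQ; have [L cL bL] := ps1 Q Qn rkQ; exists L => //.
  exact: k2 cL.
move=> j g gn; have [jE|jE] := boolP ((j == jx) && (g == i.+1)).
  case/andP: jE => /eqP-> /eqP->; exists J => //.
  by rewrite eqxx !ltnS leqnn orbT addn1.
have [L cL bL] := rs1 j g gn; exists L; last first.
  move: bL jE; rewrite [in (g < i.+2)%N]ltnS [(g <= _)%N]leq_eqVlt.
  by case: (j == jx); case: (g == i.+1).
apply: k2 cL => // _ E; move: jE; rewrite /dst in E.
have [gE|gE] := eqVneq g i.+1.
  rewrite andbT -(inj_eq rpos_inj) => /eqP; apply.
  by move: E; rewrite gE => /addIn/eqP; rewrite eqn_pmul2r // => /eqP.
move=> _; move/eqP: gE; apply.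
have := congr1 (fun z => z %% n.+1)%N E; rewrite !modnMDl !modn_small //; lia.
Qed.
End Row.

Definition row_setup : prog :=
  (19 ::= Rd 5 (V 17);;
   21 ::= Rd 0 (V 19);;
   29 ::= Rd 1 (V 19);;
   20 ::= Rd 0 (Rd 4 (V 18)))%P.

Definition row_prog : prog :=
  (row_setup;;
   PIf (V 20 <= V 21)
     (16 ::= V 18;;
      fill_prog 8 #0 #0;;
      (14 ::= #(-1);; 15 ::= #0);;
      PFor 22 gap_body;;
      PFor 22 pause_body;;
      PFor 22 take_body)
     PSkip)%P.

Lemma row_spec s jx jk : context s ->
  vars s 17 = (dpos jk)%:Z -> vars s 18 = (rpos jx)%:Z ->
  rows s (dpos jk) (rpos jx) ->
  bounds_ok row_prog s /\ rows (sem row_prog s) (dpos jk) (rpos jx).+1.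
Proof.
move=> cs s17 s18 rs; rewrite /row_prog.
have ag1 := sem_agree row_setup s.
have e19 : vars (sem row_setup s) 19 = jk%:Z by rewrite /= s17 ctx_dpos.
have e21 : vars (sem row_setup s) 21 = r jk by rewrite /= s17 ctx_dpos // ctx_r.
have e29 : vars (sem row_setup s) 29 = d jk by rewrite /= s17 ctx_dpos // ctx_d.
have e20 : vars (sem row_setup s) 20 = r jx by rewrite /= s18 ctx_rpos // ctx_r.
apply: (@wp_seq (fun s' => rows s' _ _)); first by [].
move: (sem row_setup s) ag1 e19 e21 e29 e20 => s1 ag1 e19 e21 e29 e20.
have s1E y : arrs s1 y = arrs s y by apply: ag1.2.
have {}rs : rows s1 (dpos jk) (rpos jx) by apply: (cells_arrs jx jk _ s1E).1 rs.
have rv1 : row_vars jx jk s1.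
  split=> //; last by rewrite ag1.1.
  exact: context_agree ag1 _ _ cs.
rewrite sem_if bounds_if (_ : eval s1 _ = (r jx <= r jk)%R%:Z); last by rewrite /= e20 e21.
rewrite bool_neq0; case: ifP => ark; last first.
  split=> // j g gn; have [J cJ [bl bJ]] := rs j g gn; exists J => //.
  rewrite ltnS leq_eqVlt (inj_eq rpos_inj); have [jE|//] := eqVneq j jx.
  move: bl bJ; rewrite jE ltnn addn0 addn1 => -[hJ kJ sJ fJ] bJ.
  split; first by split=> // i /kJ; exact: leqW.
  move=> J' [hJ' kJ' sJ' fJ'] cJ'; apply: bJ => //; split=> // i iJ.
  have := kJ' i iJ; rewrite ltnS leq_eqVlt => /orP[/eqP/dpos_inj ij|//].
  by have := sJ' i iJ; rewrite ij ark.
set c1 := (16 ::= V 18)%P; have ag2 := sem_agree c1 s1.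
have e16 : vars (sem c1 s1) 16 = (rpos jx)%:Z by rewrite /= (rv_x rv1).
apply: (@wp_seq (fun s' => rows s' _ _)); first by [].
move: (sem c1 s1) ag2 e16 => s2 ag2 e16.
have rv2 : row_vars jx jk s2 by apply: row_vars_agree ag2 _ _ rv1.
have s2E y : arrs s2 y = arrs s1 y by apply: ag2.2.
have {}rs : rows s2 (dpos jk) (rpos jx) by apply: (cells_arrs jx jk _ s2E).1 rs.
have [||||b3 c3 k3] := @fill_spec 8 (Const 0) (Const 0) s2 (rpos jx) set0.
- by rewrite ctx_n //; case: rv2.
- by [].
- by rewrite /= /set_weight big_set0.
- by move=> s' j _ _ _; rewrite inE.
have ag3 := sem_agree (fill_prog 8 (Const 0) (Const 0)) s2.
apply: (@wp_seq (fun s' => rows s' _ _)); first exact: b3.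
move: (sem (fill_prog _ _ _) s2) c3 k3 ag3 => s3 c3 k3 ag3.
have rv3 : row_vars jx jk s3 by apply: row_vars_agree ag3 _ _ rv2.
have {}rs : rows s3 (dpos jk) (rpos jx) by apply: rows_keeps k3 rs.
set c2 := (14 ::= #(-1);; 15 ::= #0)%P; have ag4 := sem_agree c2 s3.
have e14 : vars (sem c2 s3) 14 = -1 by [].
have e15 : vars (sem c2 s3) 15 = 0 by [].
apply: (@wp_seq (fun s' => rows s' _ _)); first by [].
move: (sem c2 s3) ag4 e14 e15 => s4 ag4 e14 e15.
have s4E y : arrs s4 y = arrs s3 y by apply: ag4.2.
have rv4 : row_vars jx jk s4 by apply: row_vars_agree ag4 _ _ rv3.
have {}c3 : cell s4 8 (rpos jx) set0 by apply: cell_arrs (s4E _) (s4E _) c3.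
have {}rs : rows s4 (dpos jk) (rpos jx) by apply: (cells_arrs jx jk _ s4E).1 rs.
have [b5 rs5 gs5] := gaps_spec rv4 rs c3 e14 e15 ark.
have ag5 := sem_agree (PFor 22 gap_body) s4.
apply: (@wp_seq (fun s' => rows s' _ _)); first exact: b5.
move: (sem (PFor 22 gap_body) s4) rs5 gs5 ag5 => s5 rs5 gs5 ag5.
have rv5 : row_vars jx jk s5 by apply: row_vars_agree ag5 _ _ rv4.
have [b6 rs6 ps6] := pauses_spec rv5 rs5 gs5 ltac:(by rewrite ag5.1) ltac:(by rewrite ag5.1) ark.
have ag6 := sem_agree (PFor 22 pause_body) s5.
apply: (@wp_seq (fun s' => rows s' _ _)); first exact: b6.
move: (sem (PFor 22 pause_body) s5) rs6 ps6 ag6 => s6 rs6 ps6 ag6.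
have rv6 : row_vars jx jk s6 by apply: row_vars_agree ag6 _ _ rv5.
exact: takes_spec rv6 rs6 ps6 ark.
Qed.

Definition insert_prog : prog := PFor 17 (PFor 18 row_prog).

Lemma insert_spec s : context s -> rows s 0 0 ->
  bounds_ok insert_prog s /\ rows (sem insert_prog s) n 0.
Proof.
move=> cs rs; apply: (sem_for (Inv := fun i s' => rows s' i 0)); [by []|by []|by []|..].
- exact: ctx_n.
- by [].
move=> i s1 iN ag1 i17 rs1; have c1 : context s1 by apply: context_agree ag1 _ _ cs.
have [jk jki] := dpos_surj iN.
suff [b rs'] : bounds_ok (PFor 18 row_prog) s1 /\ rows (sem (PFor 18 row_prog) s1) i n.
  split=> // j g gn; have [J cJ bJ] := rs' j g gn; exists J => //.
  by move: bJ; rewrite rpos_lt addn1 addn0.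
apply: (sem_for (Inv := fun x s' => rows s' i x)); [by []|by []|by []|..].
- exact: ctx_n.
- by [].
move=> x s2 xN ag2 x18 rs2; have c2 : context s2 by apply: context_agree ag2 _ _ c1.
have [jx jxx] := rpos_surj xN; rewrite -jki -jxx in rs2 *.
by apply: row_spec => //; rewrite ?jxx // ag2.1 // jki.
Qed.

Definition tail (x : nat) J : Prop := forall j, j \in J -> (x <= rpos j)%N.

Definition tail_start (x : nat) J : Prop :=
  forall j, j \in J -> exists2 i, (x <= rpos i)%N & r i <= r j.

Definition best_tail x J : Prop :=
  [/\ hall I J, tail_start x J & forall J', hall I J' -> tail x J' ->
    (set_weight I J' <= set_weight I J)%N].

(* For the sentinel position n, at which no block starts, the value read from
   the array of release times is junk, masked by the test V 12 < V 0. *)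
Definition chain_pre : prog :=
  (12 ::= V 5 + #1;;
   23 ::= V 28 * ((V 12 == V 0) +
     (V 12 < V 0) * (V 20 + V 28 * V 1 <= Rd 0 (Rd 4 (V 12))));;
   11 ::= V 18 * (V 0 + #1) + V 23;;
   13 ::= (V 18 <= V 5))%P.

Definition chain_setup : prog :=
  (28 ::= V 22 + #1;;
   16 ::= V 18;;
   7 ::= Rd 10 (V 18);;
   14 ::= #(-1);;
   15 ::= #0)%P.

Definition chain_body : prog := (chain_setup;; best_prog chain_pre 6 10 10)%P.

Definition chain_start : prog :=
  (18 ::= V 0 - #1 - V 17;; 20 ::= Rd 0 (Rd 4 (V 18)))%P.

Definition chain_prog : prog := PFor 17 (chain_start;; PFor 22 chain_body)%P.

Section Chain.
Variable jx : 'I_n.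
Let x := rpos jx.
Let a := r jx.

Definition later_tails s : Prop := forall y, (x < y <= n)%N ->
  exists2 J, cell s 10 y J & best_tail y J.

Definition chained g J : Prop :=
  [/\ hall I J, tail_start x J,
   (0 < g)%N -> forall J', hall I J' -> tail x.+1 J' ->
     (set_weight I J' <= set_weight I J)%N &
   forall h A B, (0 < h <= g)%N -> block I dpos n a h A -> #|A| = h ->
     hall I B -> starts I B (a + (p * h)%N%:Z) ->
     (set_weight I A + set_weight I B <= set_weight I J)%N].

Lemma chained_best J : chained n J -> best_tail x J.
Proof.
move=> [hJ tJ D1 D2]; split=> // J' hJ' tJ'.
have n0 : (0 < n)%N by apply: leq_ltn_trans (rpos_lt jx).
have [jJ|jJ] := boolP (jx \in J').
  have sJ' : starts I J' (r jx).
    move=> j /tJ'; rewrite leq_eqVlt => /orP[/eqP/rpos_inj->//|]; exact: rpos_mono.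
  have kJ' : below dpos n J' by move=> j _.
  have [g [A [B [g0 JE dis [blA cA sB]]]]] := chain_split hJ' kJ' sJ' jJ.
  have gn : (g <= n)%N by rewrite -cA -[X in (_ <= X)%N]card_ord max_card.
  have hB : hall I B by apply: hall_sub hJ'; rewrite JE subsetUr.
  by rewrite JE (set_weightU _ dis); apply: (D2 g A B _ blA cA hB sB); rewrite g0.
apply: D1 => // j jJ'; rewrite ltn_neqAle tJ' // andbT.
by apply: contraNneq jJ => /rpos_inj->.
Qed.

Lemma chain_step s g J0 : context s -> rows s n 0 -> later_tails s ->
  vars s 18 = x%:Z -> vars s 20 = a -> vars s 28 = g.+1%:Z -> vars s 16 = x%:Z ->
  vars s 7 = arrs s 10 x%:Z -> vars s 14 = -1 -> vars s 15 = 0 -> (g < n)%N ->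
  cell s 10 x J0 -> chained g J0 ->
  let c := best_prog chain_pre 6 10 10 in
  [/\ bounds_ok c s, keeps 10 x s (sem c s) &
    exists2 J, cell (sem c s) 10 x J & chained g.+1 J].
Proof.
move=> cs rs ts s18 s20 s28 s16 s7 s14 s15 gn c0 [hJ0 tJ0 D1 D2] pg.
have p0 := plen_gt0 I.
pose R (m : nat) : int := arrs s 0 (arrs s 4 m%:Z).
have RE j : R (rpos j) = r j by rewrite /R ctx_rpos // ctx_r.
pose h (m : nat) : nat := if (m.+1 == n) || (a + (p * g.+1)%N%:Z <= R m.+1)%R
  then g.+1 else 0%N.
pose ia (m : nat) := (x * n.+1 + h m)%N.
pose SA m := getset s 6 (ia m); pose SB m := getset s 10 m.+1.
pose ok (m : nat) : bool := (x <= m)%N.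
have cells m : (m < n)%N -> ok m -> [/\ cell s 6 (ia m) (SA m),
    cell s 10 m.+1 (SB m), best_block I dpos n a (h m) (SA m) & best_tail m.+1 (SB m)].
  move=> mn mok.
  have [|JA cA bA] := rs jx (h m) _; first by rewrite /h; case: ifP.
  have [|JB cB bB] := ts m.+1 _; first by apply/andP; split.
  rewrite /SA (cell_getset cA) /SB (cell_getset cB); split=> //.
  by rewrite addn0 in bA.
have union m : (m < n)%N -> ok m -> [/\ hall I (SA m :|: SB m),
    tail_start x (SA m :|: SB m) & [disjoint SA m & SB m]].
  move=> mn mok; have [_ _ [[hA _ sA fA] _] [hB tB _]] := cells m mn mok.
  have sB : starts I (SB m) (a + (p * h m)%N%:Z).
    move=> j /tB[i mi ir]; apply: le_trans ir.
    have xi : (x < rpos i)%N by apply: leq_ltn_trans mok mi.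
    rewrite /h; case: ifP => [|_]; last by rewrite muln0 addr0; exact: rpos_mono.
    case/orP => [/eqP mE|aR]; first by have := rpos_lt i; lia.
    apply: le_trans aR _; have [j' j'm] := rpos_surj (leq_ltn_trans mi (rpos_lt i)).
    rewrite -j'm RE; move: mi; rewrite -j'm leq_eqVlt.
    by case/orP => [/eqP/rpos_inj->//|]; exact: rpos_mono.
  split; [exact: hall_setU hA fA hB sB| |exact: fits_disjoint fA sB].
  move=> j; rewrite inE => /orP[/sA|/tB[i mi ir]]; first by exists jx.
  by exists i => //; apply: leq_trans (leqW mok) mi.
have best1 J' : hall I J' -> tail x.+1 J' -> exists2 m, (m < n)%N /\ ok m &
    (set_weight I J' <= set_weight I (set0 :|: (SA m :|: SB m)))%N.
  move=> hJ' tJ'; have xn := rpos_lt jx; exists x; first by rewrite /ok.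
  have [_ _ _ [_ _ bB]] := cells x xn (leqnn _).
  have [_ _ dis] := union x xn (leqnn _); have := bB J' hJ' tJ'.
  rewrite set0U (set_weightU _ dis); lia.
have best2 A B : block I dpos n a g.+1 A -> #|A| = g.+1 -> hall I B ->
    starts I B (a + (p * g.+1)%N%:Z) -> exists2 m, (m < n)%N /\ ok m &
    (set_weight I A + set_weight I B <= set_weight I (set0 :|: (SA m :|: SB m)))%N.
  move=> blA cA hB sB; have xn := rpos_lt jx.
  have [m [mn mok hm tB]] : exists m, [/\ (m < n)%N, ok m, h m = g.+1 & tail m.+1 B].
    case: (set_0Vmem B) => [->|[j0 j0B]].
      exists n.-1; have n0 : n.-1.+1 = n by lia.
      rewrite /ok /h n0 eqxx; split=> //; try lia; by move=> j; rewrite inE.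
    case: (@arg_minnP _ j0 (mem B) rpos j0B) => j jB jmin.
    have xj : (x < rpos j)%N.
      rewrite ltnNge leq_eqVlt; apply/negP => /orP[/eqP/rpos_inj jE|/rpos_mono];
        have := sB _ jB; rewrite ?jE mulnS -/a; lia.
    have jE : (rpos j).-1.+1 = rpos j by lia.
    have jn := rpos_lt j.
    exists (rpos j).-1; rewrite /ok /h jE RE (sB _ jB) orbT; split=> //; lia.
  exists m => //; have [_ _ [_ bA] [_ _ bB]] := cells m mn mok.
  have [_ _ dis] := union m mn mok; rewrite hm in bA.
  have := bA A blA cA; have := bB B hB tB.
  rewrite set0U (set_weightU _ dis); lia.
have [|||||||||m s' mn ag m5|m mn mok|m mn mok|bc kc res] :=
    @best_spec chain_pre 6 10 10 s x set0 ok ia S SA SB.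
- exact: weight_bound.
- by [].
- by [].
- by [].
- by [].
- exact: ctx_n.
- by [].
- by rewrite s15 /set_weight big_set0.
- by move=> j; rewrite inE s14.
- have e18 : vars s' 18 = x%:Z by rewrite ag.1.
  have e20 : vars s' 20 = a by rewrite ag.1.
  have e28 : vars s' 28 = g.+1%:Z by rewrite ag.1.
  have e0 : vars s' 0 = n%:Z by rewrite ag.1 // ctx_n.
  have e1 : vars s' 1 = p%:Z by rewrite ag.1 // ctx_p.
  have m1 : m%:Z + 1 = m.+1%:Z by lia.
  have RmE : arrs s' 0 (arrs s' 4 m.+1%:Z) = R m.+1 by rewrite !ag.2.
  rewrite /= e18 e20 e28 e0 e1 m5 m1 RmE bool_neq0.
  split=> // _; split=> //.
  rewrite /ia /h boolM eqz_nat ltz_nat -PoszM (mulnC _ p).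
  case: (eqVneq m.+1 n) => [->|mn'] /=; rewrite ?ltnn /= ?addr0 ?mulr1.
    by rewrite -(addn1 n); lia.
  have -> : (m.+1 < n)%N by rewrite ltn_neqAle mn'.
  by rewrite /= add0r; case: (_ <= _); rewrite ?mulr1 ?mulr0 -(addn1 n); lia.
- have [cA cB _ _] := cells m mn mok; have [_ _ dis] := union m mn mok; split=> //.
  by rewrite -setI_eq0 set0I.
- by split=> // _ mE; move: mok; rewrite /ok -mE ltnn.
have w0 : vars s 7 = (set_weight I J0)%:Z by rewrite s7; case: c0.
have conclude J : hall I J -> tail_start x J ->
    (set_weight I J0 <= set_weight I J)%N ->
    (forall m, (m < n)%N -> ok m ->
       (set_weight I (set0 :|: (SA m :|: SB m)) <= set_weight I J)%N) ->
    chained g.+1 J.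
  move=> hJ tJ le0 lem; split=> // [_ J' hJ' tJ'|l A B /andP[l0 lg] blA cA hB sB].
    by have [m [mn mok] le] := best1 J' hJ' tJ'; apply: leq_trans le (lem m mn mok).
  move: lg; rewrite leq_eqVlt => /orP[/eqP lE|lg]; last first.
    by apply: leq_trans le0; apply: (D2 l) => //; rewrite l0.
  rewrite lE in blA cA sB; have [m [mn mok] le] := best2 A B blA cA hB sB.
  exact: leq_trans le (lem m mn mok).
split=> //; case: res => [[m [mn mok cm mlt mmax]]|[mle sE]].
  eexists; first exact: cm.
  have [hU tU dis] := union m mn mok; apply: conclude.
  - by rewrite set0U.
  - by rewrite set0U.
  - by move: mlt; rewrite w0 ltz_nat; exact: ltnW.
  - by move=> m' m'n m'ok; have := mmax m' m'n m'ok; rewrite lez_nat.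
exists J0; first by apply: cell_arrs c0; apply: sE.
apply: conclude => // m mn mok.
by have := mle m mn mok; rewrite w0 lez_nat.
Qed.

End Chain.

Lemma hall_set0 : hall I set0.
Proof. by have [] := block_set0 0 0 0. Qed.

Lemma chain_spec s : context s -> rows s n 0 ->
  (forall y, (y <= n)%N -> cell s 10 y set0) ->
  bounds_ok chain_prog s /\
  exists2 J, cell (sem chain_prog s) 10 0 J & best_tail 0 J.
Proof.
move=> cs rs zs.
pose unset i (s' : state) := forall y, (y < n - i)%N -> cell s' 10 y set0.
pose tails i (s' : state) := forall y, (n - i <= y <= n)%N ->
  exists2 J, cell s' 10 y J & best_tail y J.
suff [b [_ _ t]] : bounds_ok chain_prog s /\ [/\ rows (sem chain_prog s) n 0,
    unset n (sem chain_prog s) & tails n (sem chain_prog s)].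
  by split=> //; apply: t; rewrite subnn.
apply: (sem_for (Inv := fun i s' => [/\ rows s' n 0, unset i s' & tails i s']));
  [by []|by []|by []|..].
- exact: ctx_n.
- split=> // y; rewrite subn0; first by move=> yn; apply: zs; exact: ltnW.
  rewrite -eqn_leq => /eqP<-; exists set0; first exact: zs.
  split=> [|j|J' _ tJ']; rewrite ?inE //; first exact: hall_set0.
  rewrite (_ : J' = set0) //; apply/setP => j; rewrite inE; apply/negP => /tJ'.
  by rewrite leqNgt rpos_lt.
move=> i s1 iN ag1 i17 [rs1 zs1 ts1].
have c1 : context s1 by apply: context_agree ag1 _ _ cs.
have [jx jxE] := @rpos_surj (n - i.+1)%N ltac:(lia).
have ag2 := sem_agree chain_start s1.
have e18 : vars (sem chain_start s1) 18 = (rpos jx)%:Z.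
  by rewrite /= ctx_n // i17 jxE; lia.
have e20 : vars (sem chain_start s1) 20 = r jx.
  have -> : vars (sem chain_start s1) 20 = arrs s1 0 (arrs s1 4 (vars (sem chain_start s1) 18)).
    by [].
  by rewrite e18 ctx_rpos // ctx_r.
apply: (@wp_seq (fun s' => [/\ rows (set_var s' 17 i.+1%:Z) n 0,
  unset i.+1 (set_var s' 17 i.+1%:Z) & tails i.+1 (set_var s' 17 i.+1%:Z)])); first by [].
move: (sem chain_start s1) ag2 e18 e20 => s2 ag2 e18 e20.
have c2 : context s2 by apply: context_agree ag2 _ _ c1.
have s2E y : arrs s2 y = arrs s1 y by apply: ag2.2.
pose inv g (s' : state) := [/\ rows s' n 0, unset i.+1 s', later_tails jx s' &
  exists2 J, cell s' 10 (rpos jx) J & chained jx g J].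
suff [b [rs' zs' ts' [J cJ bJ]]] : bounds_ok (PFor 22 chain_body) s2 /\
    inv n (sem (PFor 22 chain_body) s2).
  split=> //; split=> // y /andP[yl yn].
  have [yx|yx] := eqVneq y (rpos jx).
    by exists J; rewrite yx //; exact: chained_best.
  by apply: ts'; rewrite yn andbT ltn_neqAle eq_sym yx jxE.
apply: (sem_for (Inv := inv)); [by []|by []|by []|..].
- exact: ctx_n.
- split.
  + by move=> j g gn; have [J ? ?] := rs1 j g gn;
    exists J => //; apply: cell_arrs (s2E _) (s2E _) _.
  + by move=> y yn; apply: cell_arrs (s2E _) (s2E _) _; apply: zs1; lia.
  + move=> y yn; have [|J cJ bJ] := ts1 y; first by rewrite jxE in yn; lia.
    by exists J => //; apply: cell_arrs (s2E _) (s2E _) _.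
  + exists set0; first by apply: cell_arrs (s2E _) (s2E _) _; apply: zs1; lia.
    split=> [|j|//|h A B /andP[h0]]; rewrite ?inE //; first exact: hall_set0.
    by rewrite leqNgt h0.
move=> g s3 gN ag3 g22 [rs3 zs3 ts3 [J0 cJ0 bJ0]].
have c3 : context s3 by apply: context_agree ag3 _ _ c2.
have e18' : vars s3 18 = (rpos jx)%:Z by rewrite ag3.1.
have e20' : vars s3 20 = r jx by rewrite ag3.1.
have ag4 := sem_agree chain_setup s3.
have f28 : vars (sem chain_setup s3) 28 = g.+1%:Z by rewrite /= g22; lia.
have f16 : vars (sem chain_setup s3) 16 = (rpos jx)%:Z by rewrite /= e18'.
have f7 : vars (sem chain_setup s3) 7 = arrs s3 10 (rpos jx)%:Z by rewrite /= e18'.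
have f14 : vars (sem chain_setup s3) 14 = -1 by [].
have f15 : vars (sem chain_setup s3) 15 = 0 by [].
apply: (@wp_seq (fun s' => inv g.+1 (set_var s' 22 g.+1%:Z))); first by [].
move: (sem chain_setup s3) ag4 f28 f16 f7 f14 f15 => s4 ag4 f28 f16 f7 f14 f15.
have s4E y : arrs s4 y = arrs s3 y by apply: ag4.2.
have c4 : context s4 by apply: context_agree ag4 _ _ c3.
have rs4 : rows s4 n 0.
  by move=> j h hn; have [J ? ?] := rs3 j h hn;
    exists J => //; apply: cell_arrs (s4E _) (s4E _) _.
have ts4 : later_tails jx s4.
  by move=> y yn; have [J ? ?] := ts3 y yn;
    exists J => //; apply: cell_arrs (s4E _) (s4E _) _.
have cJ4 : cell s4 10 (rpos jx) J0 by apply: cell_arrs (s4E _) (s4E _) _.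
have [|||b5 k5 [J cJ bJ]] := chain_step c4 rs4 ts4 _ _ f28 f16 _ f14 f15 gN cJ4 bJ0.
- by rewrite ag4.1.
- by rewrite ag4.1.
- by rewrite s4E.
split=> //; split.
- by move=> j h hn; have [L cL bL] := rs4 j h hn; exists L => //; exact: k5 cL.
- move=> y yn; apply: (k5 10 y set0) => //; first by move=> _; rewrite jxE; lia.
  by apply: cell_arrs (s4E _) (s4E _) _; apply: zs3.
- move=> y yn; have [L cL bL] := ts4 y yn; exists L => //.
  by apply: k5 cL => // _; lia.
- by exists J.
Qed.

Definition output_prog : prog := PFor 6 (PStore 3 (V 6) (Rd 11 (V 6))).

Lemma output_spec s J : vars s 0 = n%:Z -> cell s 10 0 J ->
  bounds_ok output_prog s /\ output_set n (sem output_prog s) = J.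
Proof.
move=> s0 [_ bJ].
have [b H] : bounds_ok output_prog s /\ forall j : 'I_n, (j < n)%N ->
    arrs (sem output_prog s) 3 j%:Z = (j \in J)%:Z.
  apply: (sem_for (Inv := fun i s' => forall j : 'I_n, (j < i)%N ->
    arrs s' 3 j%:Z = (j \in J)%:Z)) => //.
  move=> i s' iN ag i6 IH; split=> // j ji; rewrite /= i6 eqz_nat.
  have := bJ (Ordinal iN); rewrite mul0n add0n /= => Ei.
  rewrite ag.2 // Ei; case: eqP => [jE|jE].
    by have -> : j = Ordinal iN by apply: val_inj.
  by apply: IH; lia.
by split=> //; apply/setP => j; rewrite inE H // bool_neq0.
Qed.
End Run.

Definition main_prog : prog :=
  PSeq (sort_prog 0 4) (PSeq (sort_prog 1 5)
    (PSeq insert_prog (PSeq chain_prog output_prog))).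

Definition var_degree (x : nat) : nat :=
  nth 10 [:: 1; 1; 1; 1; 10; 1; 1; 2; 10; 10; 2; 10; 10; 10; 10; 10; 10; 1; 3;
    10; 1; 1; 1; 3; 4; 1; 2; 4; 2; 10; 2]%N x.

Definition arr_degree (a : nat) : nat := if a \in [:: 0; 1; 2; 4; 5]%N then 1 else 2.

Lemma main_prog_ok : prog_ok var_degree arr_degree 24 main_prog.
Proof. by vm_compute. Qed.

Lemma main_prog_nesting : nesting main_prog = 4.
Proof. by vm_compute. Qed.

Lemma rank_surj n key x : (x < n)%N -> exists j : 'I_n, rank n key j = x.
Proof.
move=> xn; pose f (j : 'I_n) := Ordinal (rank_max key (ltn_ord j)).
have f_inj : injective f.
  by move=> i j [] /rank_inj ij; apply/val_inj/ij.
have [j jE] := codomP (injF_onto f_inj (Ordinal xn)).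
by exists j; exact: esym (congr1 val jE).
Qed.

Section Input.
Variables (n : nat) (I : instance n).
Let Z := (magnitude I).+2.

Lemma array_ofE (f : 'I_n -> int) j : array_of f (j : 'I_n)%:Z = f j.
Proof. by rewrite /array_of valK. Qed.

Lemma array_of_bounded (f : 'I_n -> int) M i :
  (forall j, (`|f j| <= M)%N) -> (`|array_of f i| <= M)%N.
Proof.
move=> fM; case: i => m; rewrite /= ?absz0 //.
by case: insubP => [u|] * /=; rewrite ?absz0.
Qed.

Lemma input_magnitude j :
  [/\ (`|release I j| <= Z)%N, (`|deadline I j| <= Z)%N & (weight I j <= Z)%N].
Proof.
rewrite /Z /magnitude; set M := \max_(i < n) _.
have H : (maxn `|release I j| (maxn `|deadline I j| (weight I j)) <= M)%N.
  exact: (leq_bigmax j).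
by clearbody M; split; lia.
Qed.

Lemma input_bounded : bounded var_degree arr_degree Z (input_state I).
Proof.
have Z0 e : (0 < Z ^ e)%N by rewrite expn_gt0.
split.
  case=> [|[|x]] /=; rewrite ?absz_nat ?expn1 ?absz0 //; rewrite /Z /magnitude; lia.
case=> [|[|[|a]]] i /=; rewrite ?absz0 // expn1; apply: array_of_bounded => j;
  by case: (input_magnitude j).
Qed.

Lemma set_weight_bound J : (set_weight I J <= Z ^ 2)%N.
Proof.
rewrite expnS expn1; apply: leq_trans (_ : (n * Z <= _)%N); last first.
  by rewrite leq_mul2r /Z /magnitude; lia.
rewrite -[X in (X * _)%N]card_ord -sum_nat_const /set_weight big_mkcond /=.
by apply: leq_sum => j _; case: ifP => // _; case: (input_magnitude j).
Qed.

Lemma main_spec :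
  bounds_ok var_degree Z main_prog (input_state I) /\
  max_weight_feasible I (output_set n (sem main_prog (input_state I))).
Proof.
pose fine s' := max_weight_feasible I (output_set n s').
have nZ : (n <= Z)%N by rewrite /Z /magnitude; lia.
set s := input_state I.
pose rpos (j : 'I_n) := rank n (fun i => arrs s 0 i%:Z) j.
pose dpos (j : 'I_n) := rank n (fun i => arrs s 1 i%:Z) j.
have [b1 r1] := sort_spec (dv := var_degree) (Z := Z) (ka := 0%N)
  (da := 4%N) (s := s) isT nZ isT isT erefl.
have ag1 := sem_agree (sort_prog 0 4) s.
apply: (@wp_seq _ _ fine); first exact: b1.
move: (sem _ s) r1 ag1 => s1 r1 ag1.
have n1 : vars s1 0 = n%:Z by rewrite ag1.1.
have [b2 r2] := sort_spec (dv := var_degree) (Z := Z) (ka := 1%N)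
  (da := 5%N) (s := s1) isT nZ isT isT n1.
have ag2 := sem_agree (sort_prog 1 5) s1.
apply: (@wp_seq _ _ fine); first exact: b2.
move: (sem _ s1) r2 ag2 => s2 r2 ag2.
rewrite [arrs s1 1]ag1.2 // in r2.
have arrE y : y \notin [:: 4; 5]%N -> arrs s2 y = arrs s y.
  by rewrite !inE negb_or => /andP[y4 y5]; rewrite ag2.2 ?ag1.2 //= inE.
have c2 : context I rpos dpos s2.
  split.
  - by rewrite ag2.1.
  - by rewrite ag2.1 // ag1.1.
  - by move=> j; rewrite arrE //; exact: array_ofE.
  - by move=> j; rewrite arrE //; exact: array_ofE.
  - by move=> j; rewrite arrE //; exact: array_ofE.
  - by move=> j; rewrite ag2.2 //; apply: r1.
  - by move=> j; apply: r2.
have cell0 T i : (5 < T)%N -> cell I s2 T i set0.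
  move=> T5; split=> [|j]; rewrite ?inE arrE ?inE; try lia.
    by rewrite /set_weight big_set0; case: T T5 => [|[|[|]]].
  by case: T T5 => [|[|[|]]].
have rpos_inj : injective rpos.
  by move=> i j /rank_inj ij; apply/val_inj/ij.
have dpos_inj : injective dpos.
  by move=> i j /rank_inj ij; apply/val_inj/ij.
have rpos_lt j : (rpos j < n)%N by apply: rank_max.
have dpos_lt j : (dpos j < n)%N by apply: rank_max.
have rpos_mono i j : (rpos i < rpos j)%N -> release I i <= release I j.
  by move=> /(rank_mono (ltn_ord j)); rewrite -!(array_ofE (_ I)).
have dpos_mono i j : (dpos i < dpos j)%N -> deadline I i <= deadline I j.
  by move=> /(rank_mono (ltn_ord j)); rewrite -!(array_ofE (_ I)).
have rpos_surj x : (x < n)%N -> exists j, rpos j = x by apply: rank_surj.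
have dpos_surj x : (x < n)%N -> exists j, dpos j = x by apply: rank_surj.
have rows0 : rows I rpos dpos s2 0 0.
  move=> j g gn; exists set0; first exact: cell0.
  split; first exact: block_set0.
  move=> J' [_ kJ' _ _] _; rewrite (_ : J' = set0) //.
  by apply/setP => i; rewrite inE; apply/negP => /kJ'.
have [b3 rs3] := insert_spec rpos_inj rpos_surj rpos_lt rpos_mono dpos_inj dpos_surj
  dpos_mono (dv := var_degree) set_weight_bound c2 rows0.
have ag3 := sem_agree insert_prog s2.
apply: (@wp_seq _ _ fine); first exact: b3.
move: (sem _ s2) rs3 ag3 => s3 rs3 ag3.
have c3 : context I rpos dpos s3 by apply: context_agree ag3 _ _ c2.
have [|b4 [J cJ [hJ _ Jmax]]] := chain_spec (dv := var_degree) rpos_inj rpos_surj rpos_lt rpos_mono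
  dpos_lt set_weight_bound c3 rs3.
  by move=> y _; apply: cell_agree ag3 _ _ (cell0 _ _ _).
have ag4 := sem_agree chain_prog s3.
apply: (@wp_seq _ _ fine); first exact: b4.
move: (sem _ s3) cJ ag4 => s4 cJ ag4.
have n4 : vars s4 0 = n%:Z by rewrite ag4.1 // (ctx_n c3).
have [b5 out] := output_spec var_degree Z n4 cJ.
split=> //; rewrite /fine out; split; first by apply/feasibleP.
by move=> J' /feasibleP hJ'; apply: Jmax.
Qed.

End Input.

Theorem theorem1 :
  exists (algorithm : cmd) (k C : nat),
  forall (n : nat) (I : instance n),
  exists (t : nat) (s : state),
  let J := output_set n s in
  [/\ exec (value_bound I k) algorithm (input_state I) t s,
      (t <= C * maxn n 1 ^ 4)%N,
      max_weight_feasible I J,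
      exists S : assignment n, earliest_deadline_schedule I J S &
      forall S : assignment n,
        earliest_deadline_schedule I J S -> max_throughput I S].
Proof.
exists (compile main_prog), 24%N, (time_factor main_prog) => n I.
have [bI mJ] := main_spec I.
have nZ : (n <= (magnitude I).+2)%N by rewrite /magnitude; lia.
have [_ _ [t E T]] := exec_sem (Z := (magnitude I).+2) (K := 24) isT main_prog_ok
  (input_bounded I) erefl nZ bI.
exists t, (sem main_prog (input_state I)); split=> //.
- by apply: leq_trans T (time_bound _ _); rewrite main_prog_nesting.
- by apply: hall_edf; apply/feasibleP; case: mJ.
- by move=> S; apply: edf_max_throughput.
Qed.
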